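(* Let $a_0,a_1,a_2$ be complex constants, let $b$ be a complex constant, and let $p(z)$ and $h(z)$ be analytic functions in a neighborhood of the origin. Assume that $\gamma$ is not a root of unity and has the form $\gamma=e^{2\pi i\theta}$, where $\theta\in\mathbb{R}\setminus\mathbb{Q}$ is a Brjuno number. Let $\eta$ be a nonzero complex number. Then there exists an analytic solution $g(z)=\sum_{n=1}^{\infty} c_n z^n$, in a neighborhood of the origin, of the auxiliary equation \begin{align*} a_2 \gamma^{2} g''(\gamma z) g'(z) &= [g(\gamma^2 z) - p(g(\gamma z))]\,\gamma g'(\gamma z)(g'(z))^{2} + b h'(g(z))(g'(z))^{3}\\ &\quad + \Big(a_2p''(g(z)) + a_1p'(g(z)) + a_0p(g(z))\Big)(g'(z))^{3}\\ &\quad - a_1\gamma g'(\gamma z)(g'(z))^{2} - a_0 g(\gamma z)(g'(z))^{3} + a_2\gamma g'(\gamma z)g''(z) \end{align*} such that $g(0)=0$ and $g'(0)=\eta$.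
   Context: For $\theta\in\mathbb{R}\setminus\mathbb{Q}$, let $\{P_n/Q_n\}_{n\ge 0}$ be the sequence of convergents of the continued fraction of $\theta$. The number $\theta$ is a Brjuno number if $B(\theta)=\sum_{n=0}^{\infty}\frac{\log Q_{n+1}}{Q_n}<\infty$. Primes denote derivatives with respect to the complex argument; for example, $g''(\gamma z)$ is $g''$ evaluated at $\gamma z$, and $p''(g(z))$ is $p''$ evaluated at $g(z)$.
   Formalization: The constant a_2 is assumed nonzero; for a_2=0 the claim fails, e.g. a_0=a_1=a_2=0, p=0, b=1, h(z)=z, where the equation at z=0 gives η^3=0. *)

(* Defs.v *)
From Stdlib Require Import Reals ZArith.
From Coquelicot Require Import Coquelicot.

Definition irrational (x : R) : Prop :=
  ~ exists p q : Z, q <> 0%Z /\ x = (IZR p / IZR q)%R.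

(* Complete quotients x_0 = theta, x_{n+1} = 1 / (x_n - floor x_n). *)
Fixpoint cf_complete (theta : R) (n : nat) : R :=
  match n with
  | O => theta
  | S m => let x := cf_complete theta m in (/ (x - IZR (Zfloor x)))%R
  end.

Definition cf_quotient (theta : R) (n : nat) : Z := Zfloor (cf_complete theta n).

(* [cf_recur a u v n] is the value w_n of the recursion
   w_n = a_n w_{n-1} + w_{n-2} with w_{-2} = u and w_{-1} = v. *)
Fixpoint cf_recur (a : nat -> Z) (u v : Z) (n : nat) : Z :=
  match n with
  | O => (a O * v + u)%Z
  | S m => (a n * cf_recur a u v m
            + match m with O => v | S k => cf_recur a u v k end)%Z
  end.

Definition cf_P (theta : R) : nat -> Z := cf_recur (cf_quotient theta) 0 1.
Definition cf_Q (theta : R) : nat -> Z := cf_recur (cf_quotient theta) 1 0.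

(* The terms are nonnegative, so B(theta) < oo is convergence of the series. *)
Definition brjuno (theta : R) : Prop :=
  irrational theta /\
  ex_series (fun n => ln (IZR (cf_Q theta (S n))) / IZR (cf_Q theta n))%R.

Definition Cexp (z : C) : C :=
  ((exp (Re z) * cos (Im z))%R, (exp (Re z) * sin (Im z))%R).

Definition root_of_unity (z : C) : Prop :=
  exists n : nat, (0 < n)%nat /\ Cpow z n = RtoC 1.

(* f(z) = sum_n c_n z^n for all z in a neighborhood of the origin. *)
Definition expands_near0 (f : C -> C) (c : nat -> C) : Prop :=
  locally (RtoC 0)
    (fun z => @is_pseries C_AbsRing C_NormedModule c z (f z)).

Definition analytic_near0 (f : C -> C) : Prop :=
  exists c : nat -> C, expands_near0 f c.

(* [C_derive] is total, with an unspecified value where the complex derivative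
   does not exist; it is only used below on functions analytic near the
   origin, at points near the origin. *)
Definition auxiliary_equation
    (a0 a1 a2 b : C) (p h : C -> C) (gamma : C) (g : C -> C) (z : C) : Prop :=
  let g' := C_derive g in
  let g'' := C_derive (C_derive g) in
  let p' := C_derive p in
  let p'' := C_derive (C_derive p) in
  let h' := C_derive h in
  (a2 * gamma ^ 2 * g'' (gamma * z) * g' z
   = (g (gamma ^ 2 * z) - p (g (gamma * z))) * gamma * g' (gamma * z) * g' z ^ 2
     + b * h' (g z) * g' z ^ 3
     + (a2 * p'' (g z) + a1 * p' (g z) + a0 * p (g z)) * g' z ^ 3
     - a1 * gamma * g' (gamma * z) * g' z ^ 2
     - a0 * g (gamma * z) * g' z ^ 3
     + a2 * gamma * g' (gamma * z) * g'' z)%C.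

(* Main.v *)
Require Import Defs.
From Stdlib Require Import Reals ZArith Lra Lia ClassicalEpsilon.
From Coquelicot Require Import Coquelicot.
Open Scope R_scope.

(** Divided by [g'^2], the equation says that the derivative of
    [a2 gamma g'(gamma z) / g'(z)] is an expression [Psi] in [g] and [g'].
    Integrating, [u = g'] satisfies
    [a2 gamma (u(gamma z) - u(z)) = u(z) * int_0^z Psi], which determines the
    coefficients of [u] recursively, the n-th one with the small divisor
    [gamma^n - 1]. If [K] is superadditive and
    [- ln |gamma^n - 1| <= K n - K (n-1)], the weights [r^n exp (- K n)] define
    a submultiplicative l1 norm in which the recursion preserves the ball of
    radius [2 |eta|] for small [r]; if moreover [K n <= kappa n], the series
    converges.

    Such a [K] is obtained by Brjuno's counting argument. Call [n] bad at level
    [k] when its distance to the integers after multiplication by [theta] is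
    less than [|Q_k theta - P_k| / 2]. By best approximation, bad indices are at
    least [Q_{k+1}] and at least [Q_{k+1}] apart, so one branching recursion
    meets at most [2 n / Q_{k+1}] of them, each costing at most
    [ln (2 Q_{k+2})]; summing over [k] gives the Brjuno series. *)

(** * Counting small divisors *)

(** Integrating removes [g'']: in the equation as given the derivative of [u] multiplies [u], and
    differentiation is unbounded in the weighted norms, whereas the integrated form uses only
    products, dilations, compositions and primitives, all of them bounded. At degree zero the
    divisor [gamma^0 - 1] and the right-hand side both vanish, so [u 0] is free and is set to [eta].
    In positive degree the primitive raises the degree by one and contributes a factor [r]; with
    [2 |eta|] as radius of the ball, the recursive part only has to stay below [|eta|]. The obstacle
    is that one coefficient accumulates a product of divisors along a branching recursion.
    Superadditivity of [K] is what a product of series demands, and the bound on the increments of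
    [K] is what one division demands. Maximizing a count over abstract forests yields both by
    construction, so the actual recursion tree is never described. *)

(* [m] is the number of bad labels in some forest whose root labels sum to at
   most [n], the children of a node having labels of sum less than its own. *)
Inductive tree_count (bad : nat -> Prop) : nat -> nat -> Prop :=
| tree_count_O : tree_count bad 0 0
| tree_count_good n m : tree_count bad n m -> tree_count bad (S n) m
| tree_count_bad n m :
    bad (S n) -> tree_count bad n m -> tree_count bad (S n) (S m)
| tree_count_plus i j a b :
    tree_count bad i a -> tree_count bad j b -> tree_count bad (i + j) (a + b).

Definition separated (bad : nat -> Prop) (q : nat) : Prop :=
  (forall n, bad n -> (q <= n)%nat) /\
  (forall m n, bad m -> bad n -> (m < n)%nat -> (q <= n - m)%nat).

(* The third clause strengthens the bound for a subtree hanging from a bad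
   node [t]; it is what allows the bad node itself to be counted. *)
Lemma tree_count_bound (bad : nat -> Prop) (q n m : nat) :
  (1 <= q)%nat -> separated bad q -> tree_count bad n m ->
  ((n < q)%nat -> m = 0%nat) /\
  ((q <= n)%nat -> (q * m + q <= 2 * n)%nat) /\
  (forall t, bad t -> (n < t)%nat -> m = 0%nat \/ (q * m + 2 * q <= 2 * t)%nat).
Proof.
  intros Hq [Hge Hsep] H.
  induction H as [|n m _ [IH1 [IH2 IH3]]|n m Hbad _ [IH1 [IH2 IH3]]
                 |i j a b _ [IHi1 [IHi2 IHi3]] _ [IHj1 [IHj2 IHj3]]].
  - repeat split; intros; try lia.
  - repeat split.
    + intros. apply IH1. lia.
    + intros. destruct (Nat.lt_ge_cases n q) as [Hn|Hn].
      * rewrite (IH1 Hn). lia.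
      * specialize (IH2 Hn). lia.
    + intros t Ht Hlt. apply (IH3 t Ht). lia.
  - assert (Hn := Hge _ Hbad).
    (* The third clause is applied with [t] the new bad node itself: its spare [2 * q] pays for that
       node and still leaves one [q]. *)
    assert (HA : (q * S m + q <= 2 * S n)%nat).
    { destruct (IH3 (S n) Hbad (Nat.lt_succ_diag_r n)) as [->|]; nia. }
    repeat split; intros; try lia.
    right. assert (Hs := Hsep (S n) t Hbad H H0). lia.
  - assert (Ha : a = 0%nat \/ (q * a + q <= 2 * i)%nat).
    { destruct (Nat.lt_ge_cases i q); auto. }
    assert (Hb : b = 0%nat \/ (q * b + q <= 2 * j)%nat).
    { destruct (Nat.lt_ge_cases j q); auto. }
    repeat split.
    + intros. rewrite IHi1, IHj1; lia.
    + intros. destruct Ha, Hb; nia.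
    + intros t Ht Hlt.
      assert (Hi := IHi3 t Ht). assert (Hj := IHj3 t Ht).
      destruct Ha as [->|Ha].
      * destruct Hj as [->|Hj]; [lia|now left|right; lia].
      * destruct Hb as [->|Hb].
        -- destruct Hi as [->|Hi]; [lia|now left|right; lia].
        (* Two sides with bad nodes each keep a spare [q] by the second clause; together these give
           the [2 * q] required below [t]. *)
        -- right. nia.
Qed.

Lemma nat_max_exists (P : nat -> Prop) (M : nat) :
  (exists m, P m) -> (forall m, P m -> (m <= M)%nat) ->
  exists m, P m /\ forall m', P m' -> (m' <= m)%nat.
Proof.
  intros [m0 H0]. induction M as [|M IH]; intros HM.
  - exists m0. split; [easy|]. intros m' H'.
    specialize (HM _ H'). lia.
  - destruct (classic (P (S M))) as [HP|HP].
    + exists (S M). split; [easy|exact HM].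
    + apply IH. intros m Hm. assert (m <> S M) by (intros ->; easy).
      specialize (HM _ Hm). lia.
Qed.

(** [N n] is the largest count over forests of total [n]. Taking a maximum turns the constructors of
    [tree_count] into inequalities: juxtaposing forests gives superadditivity, adding a root gives
    the two increment bounds. *)
Lemma counting_function (bad : nat -> Prop) (q : nat) :
  (1 <= q)%nat -> separated bad q ->
  exists N : nat -> nat,
    (forall n, (n < q)%nat -> N n = 0%nat) /\
    (forall n, (q * N n <= 2 * n)%nat) /\
    (forall i j, (N i + N j <= N (i + j))%nat) /\
    (forall n, (N n <= N (S n))%nat) /\
    (forall n, bad (S n) -> (S (N n) <= N (S n))%nat).
Proof.
  intros Hq Hs.
  assert (Hex : forall n, exists m, tree_count bad n m /\
                  forall m', tree_count bad n m' -> (m' <= m)%nat).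
  { intros n. apply (nat_max_exists _ (2 * n)).
    - exists 0%nat. induction n; constructor; easy.
    - intros m Hm. destruct (tree_count_bound bad q n m Hq Hs Hm) as [H1 [H2 _]].
      destruct (Nat.lt_ge_cases n q) as [H|H]; [rewrite H1; lia|].
      specialize (H2 H). nia. }
  destruct (choice _ Hex) as [N HN].
  exists N. repeat split.
  - intros n Hn. destruct (HN n) as [H _].
    now apply (tree_count_bound bad q n _ Hq Hs H).
  - intros n. destruct (HN n) as [H _].
    destruct (tree_count_bound bad q n _ Hq Hs H) as [H1 [H2 _]].
    destruct (Nat.lt_ge_cases n q) as [Hn|Hn]; [rewrite H1; lia|].
    specialize (H2 Hn). lia.
  - intros i j. apply (HN (i + j)%nat). constructor; apply HN.
  - intros n. apply HN. constructor; apply HN.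
  - intros n Hb. apply HN. constructor; [easy|apply HN].
Qed.

(** * Continued fractions *)

Definition cf_err (theta : R) (n : nat) : R :=
  IZR (cf_Q theta n) * theta - IZR (cf_P theta n).

Lemma irrational_not_IZR (x : R) (z : Z) : irrational x -> x <> IZR z.
Proof.
  intros H E. apply H. exists z, 1%Z. split; [easy|]. rewrite E. field.
Qed.

Lemma irrational_minus_IZR (x : R) (z : Z) :
  irrational x -> irrational (x - IZR z).
Proof.
  intros H [p [q [Hq E]]]. apply H. exists (p + z * q)%Z, q. split; [easy|].
  rewrite plus_IZR, mult_IZR.
  replace x with (IZR p / IZR q + IZR z) by lra.
  field. now apply not_0_IZR.
Qed.

Lemma irrational_inv (x : R) : irrational x -> irrational (/ x).
Proof.
  intros H [p [q [Hq E]]]. apply H.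
  assert (Hx : x <> 0) by (apply (irrational_not_IZR x 0 H)).
  assert (Hp : p <> 0%Z).
  { intros ->. apply (Rinv_neq_0_compat x Hx). rewrite E. unfold Rdiv. ring. }
  exists q, p. split; [easy|].
  rewrite <- (Rinv_inv x), E.
  field. split; now apply not_0_IZR.
Qed.

Lemma cf_complete_irrational (theta : R) (n : nat) :
  irrational theta -> irrational (cf_complete theta n).
Proof.
  intros H. induction n as [|n IH]; [easy|].
  simpl. now apply irrational_inv, irrational_minus_IZR.
Qed.

Lemma cf_complete_S (theta : R) (n : nat) :
  cf_complete theta (S n)
  = / (cf_complete theta n - IZR (cf_quotient theta n)).
Proof. reflexivity. Qed.

Lemma cf_complete_frac (theta : R) (n : nat) :
  irrational theta ->
  0 < cf_complete theta n - IZR (cf_quotient theta n) < 1.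
Proof.
  intros H. unfold cf_quotient.
  assert (Hx := irrational_not_IZR _ (Zfloor (cf_complete theta n))
                  (cf_complete_irrational theta n H)).
  destruct (Zfloor_bound (cf_complete theta n)). lra.
Qed.

Lemma cf_complete_gt1 (theta : R) (n : nat) :
  irrational theta -> 1 < cf_complete theta (S n).
Proof.
  intros H. rewrite cf_complete_S. destruct (cf_complete_frac theta n H).
  rewrite <- Rinv_1. apply Rinv_lt_contravar; lra.
Qed.

Lemma cf_quotient_ge1 (theta : R) (n : nat) :
  irrational theta -> (1 <= cf_quotient theta (S n))%Z.
Proof.
  intros H. apply Zfloor_lub. left. now apply cf_complete_gt1.
Qed.

Lemma cf_Q_0 (theta : R) : cf_Q theta 0 = 1%Z.
Proof. unfold cf_Q. simpl. lia. Qed.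

Lemma cf_Q_SS (theta : R) (n : nat) :
  cf_Q theta (S (S n))
  = (cf_quotient theta (S (S n)) * cf_Q theta (S n) + cf_Q theta n)%Z.
Proof. reflexivity. Qed.

Lemma cf_P_SS (theta : R) (n : nat) :
  cf_P theta (S (S n))
  = (cf_quotient theta (S (S n)) * cf_P theta (S n) + cf_P theta n)%Z.
Proof. reflexivity. Qed.

Lemma cf_Q_pos_le (theta : R) (n : nat) : irrational theta ->
  (1 <= cf_Q theta n <= cf_Q theta (S n))%Z.
Proof.
  intros H. induction n as [|n IH].
  - unfold cf_Q. simpl. assert (Ha := cf_quotient_ge1 theta 0 H). lia.
  - rewrite cf_Q_SS. assert (Ha := cf_quotient_ge1 theta (S n) H). nia.
Qed.

(** This crude growth is enough to leave only finitely many levels at which a given index can be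
    bad. *)
Lemma cf_Q_ge (theta : R) (n : nat) : irrational theta ->
  (Z.of_nat n <= cf_Q theta n)%Z.
Proof.
  intros H. induction n as [|[|n] IH].
  - rewrite cf_Q_0. lia.
  - assert (Ha := cf_Q_pos_le theta 0 H). lia.
  - rewrite cf_Q_SS. assert (Ha := cf_quotient_ge1 theta (S n) H).
    assert (Hb := cf_Q_pos_le theta n H). nia.
Qed.

(** Consecutive convergents form a basis of Z^2. This serves both the lower bound on the errors and
    the change of coordinates behind best approximation. *)
Lemma cf_det (theta : R) (n : nat) :
  let d := (cf_Q theta (S n) * cf_P theta n - cf_Q theta n * cf_P theta (S n))%Z in
  d = 1%Z \/ d = (-1)%Z.
Proof.
  simpl. induction n as [|n IH].
  - right. unfold cf_Q, cf_P. simpl. ring.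
  - rewrite cf_Q_SS, cf_P_SS. destruct IH as [IH|IH]; [right|left]; nia.
Qed.

(** Up to sign the complete quotients are the ratios of successive errors. As they exceed 1, the
    errors alternate in sign and decrease. *)
Lemma cf_err_S (theta : R) (n : nat) : irrational theta ->
  cf_err theta n = - cf_complete theta (S (S n)) * cf_err theta (S n).
Proof.
  intros H.
  assert (HS : forall k, cf_complete theta (S k)
            * (cf_complete theta k - IZR (cf_quotient theta k)) = 1).
  { intros k. rewrite cf_complete_S. field.
    apply Rgt_not_eq, (cf_complete_frac theta k H). }
  induction n as [|n IH].
  - unfold cf_err, cf_Q, cf_P. cbn -[cf_complete cf_quotient].
    rewrite !plus_IZR, !mult_IZR, !plus_IZR, !mult_IZR.
    assert (H0 := HS 0%nat). assert (H1 := HS 1%nat).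
    change (cf_complete theta 0) with theta in H0.
    set (x1 := cf_complete theta 1) in *. set (x2 := cf_complete theta 2) in *.
    set (a0 := IZR (cf_quotient theta 0)) in *.
    set (a1 := IZR (cf_quotient theta 1)) in *.
    transitivity ((theta - a0) * (x2 * (x1 - a1))); [rewrite H1; ring|].
    transitivity (- x2 * (a1 * (theta - a0) - x1 * (theta - a0))); [ring|].
    rewrite H0. ring.
  - assert (E : cf_err theta (S (S n)) =
      (IZR (cf_quotient theta (S (S n))) - cf_complete theta (S (S n)))
      * cf_err theta (S n)).
    { transitivity (IZR (cf_quotient theta (S (S n))) * cf_err theta (S n)
                    + cf_err theta n).
      - unfold cf_err. rewrite cf_Q_SS, cf_P_SS, !plus_IZR, !mult_IZR. ring.
      - rewrite IH. ring. }
    rewrite E. assert (H2 := HS (S (S n))).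
    transitivity ((cf_complete theta (S (S (S n))) *
     (cf_complete theta (S (S n)) - IZR (cf_quotient theta (S (S n)))))
       * cf_err theta (S n)); [rewrite H2|]; ring.
Qed.

Lemma cf_err_neq_0 (theta : R) (n : nat) :
  irrational theta -> cf_err theta n <> 0.
Proof.
  intros H E. apply H. exists (cf_P theta n), (cf_Q theta n).
  assert (HQ := cf_Q_pos_le theta n H). split; [lia|].
  unfold cf_err in E. apply (Rmult_eq_reg_l (IZR (cf_Q theta n))).
  - field_simplify; [lra|]. apply not_0_IZR. lia.
  - apply not_0_IZR. lia.
Qed.

Lemma cf_err_alternate (theta : R) (n : nat) : irrational theta ->
  cf_err theta n * cf_err theta (S n) < 0 /\
  Rabs (cf_err theta (S n)) <= Rabs (cf_err theta n).
Proof.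
  intros H. rewrite (cf_err_S theta n H).
  assert (H1 := cf_complete_gt1 theta (S n) H).
  assert (H2 := cf_err_neq_0 theta (S n) H).
  split.
  - assert (0 < cf_err theta (S n) * cf_err theta (S n)) by nra. nra.
  - rewrite Rabs_mult, Rabs_Ropp, (Rabs_pos_eq (cf_complete _ _)) by lra.
    assert (H3 := Rabs_pos (cf_err theta (S n))). nra.
Qed.

(** The determinant, of modulus 1, equals [Q_n err_{n+1} - Q_{n+1} err_n], and each of the two terms
    is at most [Q_{n+1} |err_n|]. *)
Lemma cf_err_lower (theta : R) (n : nat) : irrational theta ->
  1 <= 2 * IZR (cf_Q theta (S n)) * Rabs (cf_err theta n).
Proof.
  intros H. destruct (cf_err_alternate theta n H) as [_ Hle].
  destruct (cf_Q_pos_le theta n H) as [HQ1 HQ2].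
  apply IZR_le in HQ1, HQ2.
  set (s := (cf_Q theta (S n) * cf_P theta n - cf_Q theta n * cf_P theta (S n))%Z).
  assert (E : IZR s = IZR (cf_Q theta n) * cf_err theta (S n)
                      - IZR (cf_Q theta (S n)) * cf_err theta n).
  { unfold s, cf_err. rewrite minus_IZR, !mult_IZR. ring. }
  assert (Hs : Rabs (IZR s) = 1).
  { destruct (cf_det theta n) as [Hd|Hd]; fold s in Hd; rewrite Hd.
    - apply Rabs_R1.
    - rewrite Rabs_left; lra. }
  rewrite E in Hs.
  assert (T := Rabs_triang (IZR (cf_Q theta n) * cf_err theta (S n))
                 (- (IZR (cf_Q theta (S n)) * cf_err theta n))).
  rewrite Rabs_Ropp, !Rabs_mult, !(Rabs_pos_eq (IZR _)) in T by lra.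
  unfold Rminus in Hs. rewrite Hs in T.
  assert (H3 := Rabs_pos (cf_err theta (S n))). nra.
Qed.

(** In the basis of two consecutive convergents, the range of [n] forces [u <> 0] and [u * v <= 0].
    The errors have opposite signs too, so the two contributions reinforce each other, and the first
    alone is already at least [|cf_err theta k|]. *)
Lemma cf_best_approximation (theta : R) (k : nat) (n p : Z) :
  irrational theta -> (1 <= n < cf_Q theta (S k))%Z ->
  Rabs (cf_err theta k) <= Rabs (IZR n * theta - IZR p).
Proof.
  intros H Hn.
  destruct (cf_err_alternate theta k H) as [Halt _].
  destruct (cf_Q_pos_le theta k H) as [HQ1 HQ2].
  set (s := (cf_Q theta (S k) * cf_P theta k - cf_Q theta k * cf_P theta (S k))%Z).
  assert (Hs : (s * s = 1)%Z).
  { destruct (cf_det theta k) as [Hd|Hd]; fold s in Hd; rewrite Hd; easy. }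
  (* Coordinates of (n, p) in the basis (Q_k, P_k), (Q_{k+1}, P_{k+1}) of Z^2. *)
  set (u := (s * (cf_Q theta (S k) * p - cf_P theta (S k) * n))%Z).
  set (v := (s * (cf_P theta k * n - cf_Q theta k * p))%Z).
  assert (En : (n = u * cf_Q theta k + v * cf_Q theta (S k))%Z).
  { transitivity (s * s * n)%Z; [rewrite Hs; ring|]. unfold u, v, s. ring. }
  assert (Ep : (p = u * cf_P theta k + v * cf_P theta (S k))%Z).
  { transitivity (s * s * p)%Z; [rewrite Hs; ring|]. unfold u, v, s. ring. }
  assert (E : IZR n * theta - IZR p
              = IZR u * cf_err theta k + IZR v * cf_err theta (S k)).
  { rewrite En, Ep at 1. unfold cf_err. rewrite !plus_IZR, !mult_IZR. ring. }
  rewrite E. clearbody u v. clear E Ep s Hs.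
  assert (Hu : u <> 0%Z).
  { intros ->. destruct (Z_le_gt_dec v 0); nia. }
  assert (Huv : (u * v <= 0)%Z).
  { apply Z.nlt_ge. intros Hlt.
    assert (Hc : (1 <= u /\ 1 <= v)%Z \/ (u <= -1 /\ v <= -1)%Z) by nia.
    destruct Hc as [Hc|Hc].
    - assert (0 <= (u - 1) * cf_Q theta k)%Z by nia.
      assert (0 <= (v - 1) * cf_Q theta (S k))%Z by nia. lia.
    - assert (0 <= (- 1 - u) * cf_Q theta k)%Z by nia.
      assert (0 <= (- 1 - v) * cf_Q theta (S k))%Z by nia. lia. }
  assert (Hu1 : (1 <= u * u)%Z) by nia.
  apply IZR_le in Huv, Hu1. rewrite mult_IZR in Huv, Hu1.
  set (x := cf_err theta k) in *. set (y := cf_err theta (S k)) in *.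
  apply Rsqr_le_abs_0. unfold Rsqr.
  assert (H1 : 0 <= (IZR u * IZR v) * (x * y)) by nra.
  assert (H2 : 0 <= (IZR v * y) * (IZR v * y)) by nra.
  assert (H3 : x * x <= (IZR u * IZR u) * (x * x)) by nra.
  nra.
Qed.

(** * The superadditive majorant of the divisor losses *)

Lemma exp_le_exp (x y : R) : x <= y -> exp x <= exp y.
Proof.
  intros [H| ->]; [left; now apply exp_increasing|apply Rle_refl].
Qed.

(* A form of Davie's lemma. *)
Lemma superadditive_majorant (theta : R) : brjuno theta ->
  exists (K : nat -> R) (kappa : R),
    K 0%nat = 0 /\
    (forall i j, K i + K j <= K (i + j)%nat) /\
    (forall n, 0 <= K n <= kappa * INR n) /\
    (forall n (p : Z),
       exp (K n - K (S n)) <= 2 * Rabs (INR (S n) * theta - IZR p)).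
Proof.
  intros [H Hser].
  set (D := fun j => Rabs (cf_err theta j)).
  (* The threshold is half of [D j] so that the difference of two bad indices comes within [D j] of
     an integer, which best approximation excludes below [q j]. *)
  set (bad := fun j n => (1 <= n)%nat /\
                exists p : Z, Rabs (INR n * theta - IZR p) < D j / 2).
  set (q := fun j => Z.to_nat (cf_Q theta (S j))).
  assert (HQ : forall j, (1 <= cf_Q theta j)%Z) by (intros j; apply cf_Q_pos_le, H).
  assert (Hq1 : forall j, (1 <= q j)%nat)
    by (intros j; unfold q; specialize (HQ (S j)); lia).
  assert (Hqj : forall j, (S j <= q j)%nat)
    by (intros j; unfold q; assert (Hj := cf_Q_ge theta (S j) H); lia).
  assert (HqR : forall j, INR (q j) = IZR (cf_Q theta (S j))).
  { intros j. unfold q. specialize (HQ (S j)).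
    rewrite INR_IZR_INZ, Z2Nat.id by lia. easy. }
  assert (Hbest : forall j n (p : Z), (1 <= n < q j)%nat ->
            D j <= Rabs (INR n * theta - IZR p)).
  { intros j n p Hn. rewrite INR_IZR_INZ.
    apply cf_best_approximation; [easy|]. unfold q in Hn. lia. }
  assert (HD : forall j, 0 < D j)
    by (intros j; apply Rabs_pos_lt, cf_err_neq_0, H).
  assert (Hsep : forall j, separated (bad j) (q j)).
  { intros j. split.
    - intros n [Hn [p Hp]]. apply Nat.nlt_ge. intros Hlt.
      assert (HB := Hbest j n p ltac:(lia)). specialize (HD j). lra.
    - intros m n [Hm [p Hp]] [Hn [p' Hp']] Hmn. apply Nat.nlt_ge. intros Hlt.
      assert (HB := Hbest j (n - m)%nat (p' - p)%Z ltac:(lia)).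
      rewrite minus_INR, minus_IZR in HB by lia.
      replace ((INR n - INR m) * theta - (IZR p' - IZR p)) with
        ((INR n * theta - IZR p') + - (INR m * theta - IZR p)) in HB by ring.
      assert (T := Rabs_triang (INR n * theta - IZR p')
                     (- (INR m * theta - IZR p))).
      rewrite Rabs_Ropp in T. lra. }
  destruct (choice _ (fun j => counting_function (bad j) (q j) (Hq1 j) (Hsep j)))
    as [N HN].
  (* The price of level [j]: if [2 * d] lies between [D (S j)] and [D j], then [2 * d >= D (S j) >=
     1 / (2 Q_{j+2}) = exp (- L j)] by [cf_err_lower]. *)
  set (L := fun j => ln (2 * IZR (cf_Q theta (S (S j))))).
  assert (HQR : forall j, 1 <= IZR (cf_Q theta j))
    by (intros j; apply IZR_le, HQ).
  assert (HL : forall j, 0 <= L j).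
  { intros j. unfold L. rewrite <- ln_1. apply ln_le; [lra|].
    specialize (HQR (S (S j))). lra. }
  (* [C0] pays for the divisors that are not even small at level 0, where [D 0 <= 2 * d]. *)
  set (C0 := Rmax 0 (- ln (D 0%nat))).
  set (K := fun n => C0 * INR n + sum_f_R0 (fun j => L j * INR (N j n)) n).
  assert (HC0 : 0 <= C0) by apply Rmax_l.
  assert (HNpos : forall j n, 0 <= L j * INR (N j n)).
  { intros j n. apply Rmult_le_pos; [easy|apply pos_INR]. }
  assert (HNz : forall j n, (n <= j)%nat -> N j n = 0%nat).
  { intros j n Hn. apply (HN j). specialize (Hqj j). lia. }
  (* Levels beyond [n] contribute nothing to [K n], so values of [K] at different indices can be
     compared under a common upper limit. *)
  assert (Hext : forall n m, (n <= m)%nat ->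
            K n = C0 * INR n + sum_f_R0 (fun j => L j * INR (N j n)) m).
  { intros n m Hnm. unfold K. f_equal. induction Hnm as [|m Hnm IH]; [easy|].
    simpl. rewrite <- IH, (HNz (S m) n) by lia. simpl. ring. }
  set (t := fun n => ln (IZR (cf_Q theta (S n))) / IZR (cf_Q theta n)).
  assert (Ht : forall n, 0 <= t n).
  { intros n. apply Rmult_le_pos.
    - rewrite <- ln_1. apply ln_le; [lra|apply HQR].
    - left. apply Rinv_0_lt_compat. specialize (HQR n). lra. }
  assert (HB : forall n, sum_f_R0 (fun j => t (S j)) n <= Series t).
  { intros n. apply Rle_trans with (sum_f_R0 t (S n)).
    - rewrite (decomp_sum t (S n)) by lia. simpl. specialize (Ht 0%nat). lra.
    - apply sum_incr; [|exact Ht].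
      apply is_series_Reals, Series_correct, Hser. }
  (* The 4 is a product of two factors: the count is at most [2 n / Q_{j+1}], and
     [ln (2 Q_{j+2}) <= 2 ln Q_{j+2}] since [Q_{j+2} >= 2]. Level [j] thus costs a multiple of the
     term [t (S j)] of the Brjuno series. *)
  exists K, (C0 + 4 * Series t). repeat split.
  - unfold K. simpl. rewrite HNz by lia. simpl. ring.
  - intros i j. rewrite (Hext i (i + j)%nat), (Hext j (i + j)%nat) by lia.
    unfold K. rewrite plus_INR.
    cut (sum_f_R0 (fun k => L k * INR (N k i)) (i + j)
         + sum_f_R0 (fun k => L k * INR (N k j)) (i + j)
         <= sum_f_R0 (fun k => L k * INR (N k (i + j)%nat)) (i + j)); [lra|].
    rewrite <- sum_plus. apply sum_Rle. intros k _.
    rewrite <- Rmult_plus_distr_l. apply Rmult_le_compat_l; [easy|].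
    rewrite <- plus_INR. apply le_INR, (HN k).
  - unfold K. apply Rplus_le_le_0_compat.
    + apply Rmult_le_pos; [easy|apply pos_INR].
    + apply cond_pos_sum. intros; apply HNpos.
  - unfold K. rewrite Rmult_plus_distr_r. apply Rplus_le_compat_l.
    apply Rle_trans with (4 * INR n * sum_f_R0 (fun j => t (S j)) n).
    2: { assert (Hn := pos_INR n). specialize (HB n). nra. }
    rewrite scal_sum. apply sum_Rle. intros j _. unfold t, L.
    assert (H2 : 2 <= IZR (cf_Q theta (S (S j)))).
    { apply IZR_le. assert (Hj := cf_Q_ge theta (S (S j)) H). lia. }
    assert (HNn : IZR (cf_Q theta (S j)) * INR (N j n) <= 2 * INR n).
    { rewrite <- HqR, <- mult_INR. change 2 with (INR 2). rewrite <- mult_INR.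
      apply le_INR, (HN j). }
    rewrite ln_mult by lra.
    assert (Hln : ln 2 <= ln (IZR (cf_Q theta (S (S j))))) by (apply ln_le; lra).
    assert (Hl0 : 0 <= ln 2) by (rewrite <- ln_1; apply ln_le; lra).
    specialize (HQR (S j)).
    assert (HNle : INR (N j n) <= 2 * INR n / IZR (cf_Q theta (S j))).
    { apply Rmult_le_reg_l with (IZR (cf_Q theta (S j))); [lra|].
      field_simplify; lra. }
    assert (HN0 := pos_INR (N j n)).
    apply Rle_trans with (2 * ln (IZR (cf_Q theta (S (S j)))) * INR (N j n));
      [nra|].
    apply Rle_trans with (2 * ln (IZR (cf_Q theta (S (S j))))
        * (2 * INR n / IZR (cf_Q theta (S j)))); [nra|].
    right. field. lra.
  - intros n p. set (d := Rabs (INR (S n) * theta - IZR p)).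
    (* [f] underestimates the increments of the counts; below it is zero, or the indicator of a
       single level. *)
    assert (Hinc : forall f : nat -> R,
       (forall j, (j <= S n)%nat -> f j <= INR (N j (S n)) - INR (N j n)) ->
       C0 + sum_f_R0 (fun j => L j * f j) (S n) <= K (S n) - K n).
    { intros f Hf. rewrite (Hext n (S n)) by lia. unfold K. rewrite S_INR.
      cut (sum_f_R0 (fun j => L j * f j) (S n) <=
           sum_f_R0 (fun k => L k * INR (N k (S n)) - L k * INR (N k n)) (S n)).
      { rewrite minus_sum. lra. }
      apply sum_Rle. intros j Hj. specialize (Hf j Hj). specialize (HL j). nra. }
    assert (Hmono : forall j, 0 <= INR (N j (S n)) - INR (N j n)).
    { intros j. cut (INR (N j n) <= INR (N j (S n))); [lra|].
      apply le_INR, (HN j). }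
    destruct (Rle_dec (D 0%nat) (2 * d)) as [Hd|Hd].
    + apply Rle_trans with (D 0%nat); [|easy].
      rewrite <- (exp_ln (D 0%nat)) by easy. apply exp_le_exp.
      assert (Hi := Hinc (fun _ => 0) (fun j _ => Hmono j)).
      assert (0 <= sum_f_R0 (fun j => L j * 0) (S n))
        by (apply cond_pos_sum; intros j; lra).
      assert (HC1 := Rmax_r 0 (- ln (D 0%nat))).
      fold C0 in HC1. lra.
    (* The values [D j] cannot all exceed [2 * d]: since [S n < q (S n)], best approximation gives
       [D (S n) <= d]. *)
    + assert (Hj : exists j, 2 * d < D j /\ D (S j) <= 2 * d).
      { apply NNPP. intros Hno.
        assert (Hall : forall j, 2 * d < D j).
        { induction j as [|j IH]; [lra|]. apply Rnot_le_lt. intros Hle.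
          apply Hno. now exists j. }
        assert (HBn := Hbest (S n) (S n) p). specialize (Hall (S n)).
        specialize (Hqj (S n)). fold d in HBn. specialize (HBn ltac:(lia)).
        assert (0 <= d) by apply Rabs_pos. lra. }
      destruct Hj as [j [Hj1 Hj2]].
      assert (Hbad : bad j (S n)).
      { split; [lia|]. exists p. fold d. lra. }
      assert (Hjn : (j <= S n)%nat).
      { assert (Hg := proj1 (Hsep j) _ Hbad). specialize (Hqj j). lia. }
      assert (Hstep : 1 <= INR (N j (S n)) - INR (N j n)).
      { destruct (HN j) as [_ [_ [_ [_ Hs]]]]. specialize (Hs n Hbad).
        apply le_INR in Hs. rewrite S_INR in Hs. lra. }
      assert (Hi := Hinc (fun k => if Nat.eq_dec k j then 1 else 0)).
      assert (HLj : L j <=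
                sum_f_R0 (fun k => L k * (if Nat.eq_dec k j then 1 else 0)) (S n)).
      { clear - Hjn HL. induction (S n) as [|m IH].
        - replace j with 0%nat by lia. simpl. lra.
        - rewrite tech5. destruct (Nat.eq_dec (S m) j) as [<-|Hne].
          + rewrite Rmult_1_r, <- (Rplus_0_l (L (S m))) at 1.
            apply Rplus_le_compat_r.
            apply (cond_pos_sum (fun k => L k * (if Nat.eq_dec k (S m) then 1 else 0))).
            intros k. specialize (HL k). destruct (Nat.eq_dec k (S m)); lra.
          + specialize (IH ltac:(lia)). lra. }
      assert (Hk : L j <= K (S n) - K n).
      { cut (C0 + sum_f_R0 (fun k => L k * (if Nat.eq_dec k j then 1 else 0)) (S n)
             <= K (S n) - K n); [lra|].
        apply Hi. intros k _. destruct (Nat.eq_dec k j) as [->|]; easy. }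
      apply Rle_trans with (exp (- L j)); [apply exp_le_exp; lra|].
      rewrite exp_Ropp. unfold L. specialize (HQR (S (S j))).
      rewrite exp_ln by lra.
      apply Rle_trans with (D (S j)); [|easy].
      assert (Hlow := cf_err_lower theta (S j) H). fold (D (S j)) in Hlow.
      apply Rmult_le_reg_l with (2 * IZR (cf_Q theta (S (S j)))); [lra|].
      rewrite Rinv_r; lra.
Qed.

(** * Lower bound for the divisors *)

(** A weak Jordan inequality, read off the Taylor polynomial of degree 7. The constant 1/3 suffices
    because [PI >= 3] turns it into [y <= sin (PI * y)]. *)
Lemma sin_ge_third (x : R) : 0 <= x <= PI / 2 -> x / 3 <= sin x.
Proof.
  intros Hx. assert (H4 := PI_4).
  apply Rle_trans with (sin_lb x); [|apply SIN; lra].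
  set (s := x * x). assert (Hs : 0 <= s <= 4) by (unfold s; nra).
  replace (sin_lb x) with (x * (5040 - 840 * s + 42 * s ^ 2 - s ^ 3) / 5040)
    by (unfold s, sin_lb, sin_approx, sin_term; simpl; field).
  assert (0 <= x * (3360 - 840 * s + s ^ 2 * (42 - s))); [|lra].
  apply Rmult_le_pos; [lra|]. assert (0 <= s ^ 2 * (42 - s)); [|lra].
  apply Rmult_le_pos; [apply pow2_ge_0|lra].
Qed.

Lemma cos_minus_period (x : R) (p : Z) : cos (x - 2 * IZR p * PI) = cos x.
Proof.
  destruct (Z_le_gt_dec 0 p) as [Hp|Hp].
  - rewrite <- (cos_period (x - 2 * IZR p * PI) (Z.to_nat p)).
    rewrite INR_IZR_INZ, Z2Nat.id by easy. f_equal. ring.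
  - rewrite <- (cos_period x (Z.to_nat (- p))).
    rewrite INR_IZR_INZ, Z2Nat.id, opp_IZR by lia. f_equal. ring.
Qed.

Lemma Cexp_angle_pow (theta : R) (n : nat) :
  (Cexp (2 * PI * Ci * theta) ^ n)%C
  = (cos (2 * PI * (INR n * theta)), sin (2 * PI * (INR n * theta))).
Proof.
  assert (E : Cexp (2 * PI * Ci * theta)
              = (cos (2 * PI * theta), sin (2 * PI * theta))).
  { unfold Cexp. replace (Re (2 * PI * Ci * theta)) with 0 by (simpl; ring).
    replace (Im (2 * PI * Ci * theta)) with (2 * PI * theta) by (simpl; ring).
    rewrite exp_0, !Rmult_1_l. easy. }
  rewrite E. induction n as [|n IH].
  - rewrite Rmult_0_l, Rmult_0_r, cos_0, sin_0. easy.
  - rewrite Cpow_S, IH, S_INR. unfold Cmult. simpl fst; simpl snd.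
    replace (2 * PI * ((INR n + 1) * theta))
      with (2 * PI * theta + 2 * PI * (INR n * theta)) by ring.
    rewrite cos_plus, sin_plus. f_equal; ring.
Qed.

Lemma Cmod_Cexp_angle (theta : R) : Cmod (Cexp (2 * PI * Ci * theta)) = 1.
Proof.
  rewrite <- (Cpow_1_r (Cexp _)), Cexp_angle_pow. generalize (2 * PI * (INR 1 * theta)).
  intros x. transitivity (sqrt 1); [|apply sqrt_1]. unfold Cmod. f_equal. simpl.
  generalize (sin2_cos2 x). unfold Rsqr. lra.
Qed.

(** With [p] the integer nearest to [n theta] and [y] the difference, the modulus is exactly
    [2 * sin (PI * |y|)]. The factor 2 is the one in the last clause of [superadditive_majorant]. *)
Lemma small_divisor_lower (theta : R) (n : nat) :
  exists p : Z, 2 * Rabs (INR n * theta - IZR p)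
                <= Cmod (Cexp (2 * PI * Ci * theta) ^ n - 1)%C.
Proof.
  set (x := INR n * theta).
  set (p := Zfloor (x + / 2)). exists p.
  assert (Hp := Zfloor_bound (x + / 2)). fold p in Hp.
  set (y := x - IZR p).
  assert (Hy : Rabs y <= / 2) by (unfold y; apply Rabs_le; lra).
  assert (HPI := PI2_3_2).
  assert (E : Cmod (Cexp (2 * PI * Ci * theta) ^ n - 1)%C = 2 * sin (PI * Rabs y)).
  { assert (Hs : 0 <= sin (PI * Rabs y)).
    { assert (H0 := Rabs_pos y). apply sin_ge_0; nra. }
    rewrite <- (sqrt_pow2 (2 * sin _)) by lra.
    rewrite Cexp_angle_pow. fold x. unfold Cmod, Cminus, Cplus, Copp, RtoC.
    simpl fst; simpl snd. f_equal.
    transitivity (2 - 2 * cos (2 * PI * x)).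
    { assert (H1 := sin2_cos2 (2 * PI * x)). unfold Rsqr in H1. nra. }
    replace (cos (2 * PI * x)) with (cos (2 * (PI * Rabs y))).
    { rewrite cos_2a_sin. ring. }
    transitivity (cos (2 * (PI * y))).
    { unfold Rabs. destruct (Rcase_abs y); [|easy].
      rewrite <- cos_neg. f_equal. ring. }
    rewrite <- (cos_minus_period (2 * PI * x) p). f_equal. unfold y. ring. }
  rewrite E. assert (H0 := Rabs_pos y).
  assert (H1 := sin_ge_third (PI * Rabs y)).
  assert (0 <= PI * Rabs y <= PI / 2) by (split; nra).
  specialize (H1 H). nra.
Qed.

(** * Formal power series and weighted l1 norms *)

Lemma sumC_S (f : nat -> C) (n : nat) :
  sum_n f (S n) = (sum_n f n + f (S n))%C.
Proof. exact (sum_Sn f n). Qed.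

Lemma sumR_S (f : nat -> R) (n : nat) : sum_n f (S n) = sum_n f n + f (S n).
Proof. exact (sum_Sn f n). Qed.

Lemma sumC_plus (f g : nat -> C) (n : nat) :
  sum_n (fun k => f k + g k)%C n = (sum_n f n + sum_n g n)%C.
Proof. exact (sum_n_plus f g n). Qed.

Lemma sumC_mult_l (c : C) (f : nat -> C) (n : nat) :
  sum_n (fun k => c * f k)%C n = (c * sum_n f n)%C.
Proof. exact (sum_n_mult_l (K := C_Ring) c f n). Qed.

Lemma sumR_mult_l (c : R) (f : nat -> R) (n : nat) :
  sum_n (fun k => c * f k) n = c * sum_n f n.
Proof. exact (sum_n_mult_l (K := R_Ring) c f n). Qed.

Lemma sumR_mult_r (c : R) (f : nat -> R) (n : nat) :
  sum_n (fun k => f k * c) n = sum_n f n * c.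
Proof. exact (sum_n_mult_r (K := R_Ring) c f n). Qed.

Lemma Cmod_sum_n (f : nat -> C) (n : nat) :
  Cmod (sum_n f n) <= sum_n (fun k => Cmod (f k)) n.
Proof.
  induction n as [|n IH]; [rewrite !sum_O; lra|].
  rewrite sumC_S, sumR_S.
  apply Rle_trans with (1 := Cmod_triangle _ _). lra.
Qed.

Lemma sumR_le (f g : nat -> R) (n : nat) :
  (forall k, (k <= n)%nat -> f k <= g k) -> sum_n f n <= sum_n g n.
Proof.
  intros H. rewrite !sum_n_Reals. now apply sum_Rle.
Qed.

Lemma sumR_ge0 (f : nat -> R) (n : nat) :
  (forall k, 0 <= f k) -> 0 <= sum_n f n.
Proof.
  intros H. rewrite sum_n_Reals. now apply cond_pos_sum.
Qed.

Lemma sumR_mono (f : nat -> R) (n m : nat) :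
  (forall k, 0 <= f k) -> (n <= m)%nat -> sum_n f n <= sum_n f m.
Proof.
  intros H Hnm. induction Hnm as [|m _ IH]; [lra|].
  rewrite sumR_S. specialize (H (S m)). lra.
Qed.

Lemma sumR_ext (f g : nat -> R) (n : nat) :
  (forall k, (k <= n)%nat -> f k = g k) -> sum_n f n = sum_n g n.
Proof. exact (sum_n_ext_loc f g n). Qed.

Lemma sumC_ext (f g : nat -> C) (n : nat) :
  (forall k, (k <= n)%nat -> f k = g k) -> sum_n f n = sum_n g n.
Proof. exact (sum_n_ext_loc f g n). Qed.

(** Two orders of summation over the same triangle; any ring is allowed so as to cover complex
    coefficients and real norms alike. *)
Lemma sum_n_convolution {K : Ring} (x y : nat -> K) (n : nat) :
  sum_n (fun m => sum_n (fun k => mult (x k) (y (m - k)%nat)) m) n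
  = sum_n (fun k => mult (x k) (sum_n y (n - k)%nat)) n.
Proof.
  induction n as [|n IH]; [now rewrite !sum_O|].
  rewrite sum_Sn, IH, !(sum_Sn _ n), Nat.sub_diag, sum_O, plus_assoc.
  f_equal. rewrite <- sum_n_plus. apply sum_n_ext_loc. intros k Hk.
  rewrite Nat.sub_succ_l, sum_Sn by easy. symmetry. apply mult_distr_l.
Qed.

Lemma sumC_convolution (x y : nat -> C) (n : nat) :
  sum_n (fun m => sum_n (fun k => x k * y (m - k)%nat)%C m) n
  = sum_n (fun k => x k * sum_n y (n - k)%nat)%C n.
Proof. exact (sum_n_convolution (K := C_Ring) x y n). Qed.

Lemma sumR_convolution (x y : nat -> R) (n : nat) :
  sum_n (fun m => sum_n (fun k => x k * y (m - k)%nat) m) n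
  = sum_n (fun k => x k * sum_n y (n - k)%nat) n.
Proof. exact (sum_n_convolution (K := R_Ring) x y n). Qed.

Lemma sumC_minus (f g : nat -> C) (n : nat) :
  sum_n (fun k => f k - g k)%C n = (sum_n f n - sum_n g n)%C.
Proof.
  induction n as [|n IH]; [now rewrite !sum_O|].
  rewrite !sumC_S, IH.
  cut (forall x y z t : C, (x - y + (z - t) = x + z - (y + t))%C); [easy|].
  intros. ring.
Qed.

Lemma sumR_minus (f g : nat -> R) (n : nat) :
  sum_n (fun k => f k - g k) n = sum_n f n - sum_n g n.
Proof.
  induction n as [|n IH]; [now rewrite !sum_O|].
  rewrite !sumR_S, IH.
  cut (forall x y z t : R, x - y + (z - t) = x + z - (y + t)); [easy|].
  intros. ring.
Qed.

Lemma sumC_mult_r (c : C) (f : nat -> C) (n : nat) :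
  sum_n (fun k => f k * c)%C n = (sum_n f n * c)%C.
Proof. exact (sum_n_mult_r (K := C_Ring) c f n). Qed.

Definition pmul (a b : nat -> C) (n : nat) : C :=
  sum_n (fun k => a k * b (n - k)%nat)%C n.

Fixpoint ppow (a : nat -> C) (m : nat) : nat -> C :=
  match m with
  | O => fun n => match n with O => RtoC 1 | S _ => RtoC 0 end
  | S m => pmul a (ppow a m)
  end.

(* Correct only when [a 0 = 0], so that [ppow a m n = 0] for [m > n]. *)
Definition pcomp (p a : nat -> C) (n : nat) : C :=
  sum_n (fun m => p m * ppow a m n)%C n.

Definition pdil (c : C) (a : nat -> C) (n : nat) : C := (c ^ n * a n)%C.

(** The primitive divided by [z]. *)
Definition pavg (a : nat -> C) (n : nat) : C := (a n / RtoC (INR (S n)))%C.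

Definition pint (a : nat -> C) (n : nat) : C :=
  match n with O => RtoC 0 | S n => pavg a n end.

Definition pder (a : nat -> C) (n : nat) : C := (RtoC (INR (S n)) * a (S n))%C.

Definition padd (a b : nat -> C) (n : nat) : C := (a n + b n)%C.

Definition pscal (c : C) (a : nat -> C) (n : nat) : C := (c * a n)%C.

Lemma RtoC_INR_S_neq0 (n : nat) : RtoC (INR (S n)) <> RtoC 0.
Proof. intros H. apply RtoC_inj in H. now apply (not_0_INR (S n)). Qed.

Lemma pder_pint (a : nat -> C) (n : nat) : pder (pint a) n = a n.
Proof.
  unfold pder, pint, pavg. field. apply RtoC_INR_S_neq0.
Qed.

(** The primitive has no constant term, so the coefficient of degree [S n] involves only indices up
    to [n]. This gain of one degree makes the recursion causal. *)
Lemma pmul_pint_S (a b : nat -> C) (n : nat) :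
  pmul a (pint b) (S n) = pmul a (pavg b) n.
Proof.
  unfold pmul. rewrite sumC_S, Nat.sub_diag. simpl pint at 2.
  rewrite Cmult_0_r, Cplus_0_r. apply sumC_ext. intros k Hk.
  now rewrite Nat.sub_succ_l.
Qed.

Lemma ppow_valuation (a : nat -> C) (m n : nat) :
  a O = RtoC 0 -> (n < m)%nat -> ppow a m n = RtoC 0.
Proof.
  intros Ha. revert n. induction m as [|m IH]; intros n Hn; [lia|].
  simpl. unfold pmul.
  rewrite (sumC_ext _ (fun _ => 0 * 0)%C).
  - rewrite (sumC_mult_l 0 (fun _ => RtoC 0)). apply Cmult_0_l.
  - intros [|k] Hk; [now rewrite Ha, !Cmult_0_l|].
    rewrite (IH (n - S k)%nat) by lia. now rewrite Cmult_0_r, Cmult_0_l.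
Qed.

(** ** Causality *)

(** Congruence modulo [z ^ n]. The operations on series preserve it; [coeff_step] raises the order
    by one. *)
Definition agree (n : nat) (a b : nat -> C) : Prop :=
  forall k, (k < n)%nat -> a k = b k.

Lemma agree_pmul n a a' b b' :
  agree n a a' -> agree n b b' -> agree n (pmul a b) (pmul a' b').
Proof.
  intros Ha Hb k Hk. apply sumC_ext. intros j Hj.
  rewrite Ha, Hb by lia. easy.
Qed.

Lemma agree_ppow n a a' m : agree n a a' -> agree n (ppow a m) (ppow a' m).
Proof.
  intros H. induction m as [|m IH]; [easy|]. now apply agree_pmul.
Qed.

Lemma agree_pcomp n p a a' : agree n a a' -> agree n (pcomp p a) (pcomp p a').
Proof.
  intros H k Hk. apply sumC_ext. intros m _. now rewrite (agree_ppow n a a' m H).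
Qed.

Lemma agree_pdil n c a a' : agree n a a' -> agree n (pdil c a) (pdil c a').
Proof. intros H k Hk. unfold pdil. now rewrite H. Qed.

Lemma agree_pavg n a a' : agree n a a' -> agree n (pavg a) (pavg a').
Proof. intros H k Hk. unfold pavg. now rewrite H. Qed.

Lemma agree_pint n a a' : agree n a a' -> agree n (pint a) (pint a').
Proof. intros H [|k] Hk; [easy|]. apply (agree_pavg n a a' H). lia. Qed.

Lemma agree_padd n a a' b b' :
  agree n a a' -> agree n b b' -> agree n (padd a b) (padd a' b').
Proof. intros Ha Hb k Hk. unfold padd. now rewrite Ha, Hb. Qed.

Lemma agree_pscal n c a a' : agree n a a' -> agree n (pscal c a) (pscal c a').
Proof. intros H k Hk. unfold pscal. now rewrite H. Qed.

(** ** Norms *)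

(** Truncated at [N], so that each estimate is a finite inequality and no convergence has to be
    known beforehand. *)
Definition wnorm (W : nat -> R) (a : nat -> C) (N : nat) : R :=
  sum_n (fun n => Cmod (a n) * W n) N.

(** For [r ^ n * exp (- K n)] the last clause is the superadditivity of [K]; the first gives the
    unit series norm 1. *)
Definition weight (W : nat -> R) : Prop :=
  W O = 1 /\ (forall n, 0 <= W n) /\ (forall i j, W (i + j)%nat <= W i * W j).

Lemma weight_pow (r : R) : 0 <= r -> weight (fun n => r ^ n).
Proof.
  intros Hr. repeat split; [intros n; now apply pow_le|].
  intros i j. rewrite pow_add. lra.
Qed.

Section Weighted.

Variable W : nat -> R.
Hypothesis HW : weight W.

Lemma weighted_ge0 (a : nat -> C) (n : nat) : 0 <= Cmod (a n) * W n.
Proof. apply Rmult_le_pos; [apply Cmod_ge_0|apply HW]. Qed.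

Lemma wnorm_ge0 a N : 0 <= wnorm W a N.
Proof. apply sumR_ge0. intros. apply weighted_ge0. Qed.

Lemma wnorm_agree a b N : agree (S N) a b -> wnorm W a N = wnorm W b N.
Proof.
  intros H. apply sumR_ext. intros k Hk. now rewrite H by lia.
Qed.

Lemma wnorm_padd a b N : wnorm W (padd a b) N <= wnorm W a N + wnorm W b N.
Proof.
  unfold wnorm. rewrite <- (sum_n_plus (G := R_AbelianMonoid)).
  apply sumR_le. intros k _.
  change (Cmod (padd a b k) * W k <= Cmod (a k) * W k + Cmod (b k) * W k).
  assert (H := Cmod_triangle (a k) (b k)).
  rewrite <- Rmult_plus_distr_r. apply Rmult_le_compat_r; [apply HW|easy].
Qed.

Lemma wnorm_pscal c a N : wnorm W (pscal c a) N = Cmod c * wnorm W a N.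
Proof.
  unfold wnorm. rewrite <- sumR_mult_l. apply sumR_ext. intros k _.
  unfold pscal. rewrite Cmod_mult. ring.
Qed.

Lemma wnorm_pdil c a N : Cmod c = 1 -> wnorm W (pdil c a) N = wnorm W a N.
Proof.
  intros Hc. apply sumR_ext. intros k _. unfold pdil.
  now rewrite Cmod_mult, Cmod_pow, Hc, pow1, Rmult_1_l.
Qed.

Lemma Cmod_pavg a n : Cmod (pavg a n) <= Cmod (a n).
Proof.
  unfold pavg. rewrite Cmod_div by apply RtoC_INR_S_neq0.
  rewrite Cmod_R, Rabs_pos_eq by apply pos_INR.
  assert (H : 1 <= INR (S n)) by (rewrite S_INR; assert (H := pos_INR n); lra).
  apply Rmult_le_reg_r with (INR (S n)); [lra|].
  unfold Rdiv. rewrite Rmult_assoc, Rinv_l by lra.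
  assert (H1 := Cmod_ge_0 (a n)). nra.
Qed.

Lemma wnorm_pavg a N : wnorm W (pavg a) N <= wnorm W a N.
Proof.
  apply sumR_le. intros k _.
  apply Rmult_le_compat_r; [apply HW|apply Cmod_pavg].
Qed.

Lemma wnorm_pint s a N :
  0 <= s -> (forall n, W (S n) <= s * W n) ->
  wnorm W (pint a) N <= s * wnorm W a N.
Proof.
  intros Hs HS.
  (* One extra term on the left makes up for the index shift, and the sums then compare term by
     term. *)
  cut (wnorm W (pint a) (S N) <= s * wnorm W a N).
  { intros H. apply Rle_trans with (2 := H).
    apply sumR_mono; [intros; apply weighted_ge0|lia]. }
  assert (Hk : forall k, Cmod (pavg a k) * W (S k) <= s * (Cmod (a k) * W k)).
  { intros k. rewrite <- Rmult_assoc, (Rmult_comm s), Rmult_assoc.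
    apply Rmult_le_compat; [apply Cmod_ge_0|apply HW|apply Cmod_pavg|apply HS]. }
  unfold wnorm. induction N as [|N IH].
  - rewrite sumR_S, !sum_O. simpl pint. rewrite Cmod_0. specialize (Hk O). lra.
  - rewrite (sumR_S _ (S N)), (sumR_S (fun n => Cmod (a n) * W n) N).
    specialize (Hk (S N)). simpl pint at 2. lra.
Qed.

Lemma wnorm_pmul a b N :
  wnorm W (pmul a b) N <= wnorm W a N * wnorm W b N.
Proof.
  destruct HW as [_ [HW0 HWm]].
  apply Rle_trans with
    (sum_n (fun n => sum_n (fun k => (Cmod (a k) * W k)
             * (Cmod (b (n - k)%nat) * W (n - k)%nat)) n) N).
  - apply sumR_le. intros n _.
    apply Rle_trans with (sum_n (fun k => Cmod (a k * b (n - k)%nat)) n * W n).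
    + apply Rmult_le_compat_r; [apply HW0|apply Cmod_sum_n].
    + rewrite <- sumR_mult_r. apply sumR_le. intros k Hk.
      rewrite Cmod_mult.
      replace (Cmod (a k) * W k * (Cmod (b (n - k)%nat) * W (n - k)%nat))
        with (Cmod (a k) * Cmod (b (n - k)%nat) * (W k * W (n - k)%nat)) by ring.
      apply Rmult_le_compat_l;
        [apply Rmult_le_pos; apply Cmod_ge_0|].
      specialize (HWm k (n - k)%nat). now replace (k + (n - k))%nat with n in HWm by lia.
  - rewrite (sumR_convolution (fun k => Cmod (a k) * W k)
               (fun k => Cmod (b k) * W k)).
    unfold wnorm. rewrite <- sumR_mult_r. apply sumR_le. intros k Hk.
    apply Rmult_le_compat_l; [apply weighted_ge0|].
    apply sumR_mono; [intros; apply weighted_ge0|lia].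
Qed.

Lemma wnorm_ppow a m N : wnorm W (ppow a m) N <= wnorm W a N ^ m.
Proof.
  induction m as [|m IH].
  - simpl. right. induction N as [|N IH].
    + unfold wnorm. rewrite sum_O, Cmod_1, (proj1 HW). ring.
    + unfold wnorm in *. rewrite sumR_S, IH, Cmod_0. ring.
  - simpl. apply Rle_trans with (1 := wnorm_pmul _ _ _).
    apply Rmult_le_compat_l; [apply wnorm_ge0|easy].
Qed.

(** Powers of [a] are controlled by submultiplicativity, so the outer series is measured with
    geometric weights whatever [W] is. Nonlinear terms of all orders thus cost only a constant. *)
Lemma wnorm_pcomp p a N (s : R) : wnorm W a N <= s ->
  wnorm W (pcomp p a) N <= wnorm (fun n => s ^ n) p N.
Proof.
  intros Hs.
  apply Rle_trans with
    (sum_n (fun n => sum_n (fun m => Cmod (p m) * (Cmod (ppow a m n) * W n)) N) N).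
  - apply sumR_le. intros n Hn.
    apply Rle_trans with (sum_n (fun m => Cmod (p m * ppow a m n)) n * W n).
    + apply Rmult_le_compat_r; [apply HW|apply Cmod_sum_n].
    + rewrite <- sumR_mult_r.
      rewrite (sumR_ext _ (fun m => Cmod (p m) * (Cmod (ppow a m n) * W n)))
        by (intros; rewrite Cmod_mult; ring).
      apply sumR_mono; [|easy]. intros m.
      apply Rmult_le_pos; [apply Cmod_ge_0|apply weighted_ge0].
  - rewrite sum_n_switch. apply sumR_le. intros m _.
    rewrite sumR_mult_l. apply Rmult_le_compat_l; [apply Cmod_ge_0|].
    apply Rle_trans with (1 := wnorm_ppow a m N).
    apply pow_incr. split; [apply wnorm_ge0|easy].
Qed.

End Weighted.

(** * Sums of convergent power series *)

(** Convergence for the modulus. The balls of [C_NormedModule] are coordinatewise; the resulting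
    factor [sqrt 2] is confined to [psum_is_pseries] and [locally_0_Cmod]. *)
Definition Clim (s : nat -> C) (l : C) : Prop :=
  forall eps, 0 < eps ->
  exists N, forall n, (N <= n)%nat -> Cmod (s n - l)%C < eps.

Lemma Clim_squeeze (s : nat -> C) (l : C) (e : nat -> R) :
  (forall n, Cmod (s n - l)%C <= e n) -> is_lim_seq e 0 -> Clim s l.
Proof.
  intros H He eps Heps. apply is_lim_seq_spec in He.
  destruct (He (mkposreal eps Heps)) as [N HN]. exists N. intros n Hn.
  specialize (HN n Hn). simpl in HN. rewrite Rminus_0_r in HN.
  specialize (H n). apply Rle_lt_trans with (1 := H).
  apply Rle_lt_trans with (1 := Rle_abs _) (2 := HN).
Qed.

Lemma Clim_is_lim_seq (s : nat -> C) (l : C) :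
  Clim s l -> is_lim_seq (fun n => Cmod (s n - l)%C) 0.
Proof.
  intros H. apply is_lim_seq_spec. intros eps.
  destruct (H eps (cond_pos eps)) as [N HN]. exists N. intros n Hn.
  rewrite Rminus_0_r, Rabs_pos_eq by apply Cmod_ge_0. now apply HN.
Qed.

Lemma Clim_const (l : C) : Clim (fun _ => l) l.
Proof.
  intros eps Heps. exists O. intros n _.
  replace (l - l)%C with (RtoC 0) by ring. now rewrite Cmod_0.
Qed.

Lemma Clim_ext (s t : nat -> C) (l : C) :
  (forall n, s n = t n) -> Clim s l -> Clim t l.
Proof.
  intros E H eps Heps. destruct (H eps Heps) as [N HN]. exists N.
  intros n Hn. rewrite <- E. now apply HN.
Qed.

Lemma Clim_S (s : nat -> C) (l : C) : Clim s l -> Clim (fun n => s (S n)) l.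
Proof.
  intros H eps Heps. destruct (H eps Heps) as [N HN]. exists N.
  intros n Hn. apply HN. lia.
Qed.

Lemma Clim_plus (s t : nat -> C) (l m : C) :
  Clim s l -> Clim t m -> Clim (fun n => s n + t n)%C (l + m)%C.
Proof.
  intros Hs Ht.
  apply (Clim_squeeze _ _ (fun n => Cmod (s n - l)%C + Cmod (t n - m)%C)).
  - intros n. replace (s n + t n - (l + m))%C with ((s n - l) + (t n - m))%C by ring.
    apply Cmod_triangle.
  - replace (Finite 0) with (Finite (0 + 0)) by (f_equal; ring).
    apply is_lim_seq_plus'; now apply Clim_is_lim_seq.
Qed.

Lemma Clim_mult_l (c : C) (s : nat -> C) (l : C) :
  Clim s l -> Clim (fun n => c * s n)%C (c * l)%C.
Proof.
  intros Hs.
  apply (Clim_squeeze _ _ (fun n => Cmod c * Cmod (s n - l)%C)).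
  - intros n. replace (c * s n - c * l)%C with (c * (s n - l))%C by ring.
    rewrite Cmod_mult. lra.
  - replace (Finite 0) with (Finite (Cmod c * 0)) by (f_equal; ring).
    apply (is_lim_seq_scal_l _ (Cmod c) 0). now apply Clim_is_lim_seq.
Qed.

Lemma Clim_mult (s t : nat -> C) (l m : C) :
  Clim s l -> Clim t m -> Clim (fun n => s n * t n)%C (l * m)%C.
Proof.
  intros Hs Ht.
  apply (Clim_squeeze _ _ (fun n => Cmod (s n - l)%C * Cmod (t n - m)%C
     + (Cmod m * Cmod (s n - l)%C + Cmod l * Cmod (t n - m)%C))).
  - intros n.
    replace (s n * t n - l * m)%C
      with ((s n - l) * (t n - m) + (m * (s n - l) + l * (t n - m)))%C by ring.
    rewrite <- !Cmod_mult. apply Rle_trans with (1 := Cmod_triangle _ _).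
    apply Rplus_le_compat_l, Cmod_triangle.
  - assert (H1 := Clim_is_lim_seq _ _ Hs). assert (H2 := Clim_is_lim_seq _ _ Ht).
    replace (Finite 0) with (Finite (0 * 0 + (Cmod m * 0 + Cmod l * 0)))
      by (f_equal; ring).
    apply is_lim_seq_plus'; [now apply is_lim_seq_mult'|].
    apply is_lim_seq_plus'; now apply (is_lim_seq_scal_l _ _ 0).
Qed.

Lemma Clim_bound (s : nat -> C) (l : C) (B : R) :
  (forall n, Cmod (s n) <= B) -> Clim s l -> Cmod l <= B.
Proof.
  intros HB H. apply Rnot_lt_le. intros Hlt.
  destruct (H (Cmod l - B)) as [N HN]; [lra|]. specialize (HN N (le_n N)).
  specialize (HB N).
  assert (T := Cmod_triangle (s N) (- (s N - l))%C).
  replace (s N + - (s N - l))%C with l in T by ring. rewrite Cmod_opp in T. lra.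
Qed.

Lemma Clim_unique (s : nat -> C) (l m : C) : Clim s l -> Clim s m -> l = m.
Proof.
  intros Hl Hm. apply Ceq_minus, Cmod_eq_0, Rle_antisym; [|apply Cmod_ge_0].
  apply (Clim_bound (fun n => s n + (-1) * s n)%C).
  - intros n. replace (s n + (-1) * s n)%C with (RtoC 0) by ring.
    rewrite Cmod_0. lra.
  - replace (l - m)%C with (l + (-1) * m)%C by ring.
    now apply Clim_plus, Clim_mult_l.
Qed.

Definition psum (a : nat -> C) (z : C) (n : nat) : C :=
  sum_n (fun k => a k * z ^ k)%C n.

(** Absolute convergence on the closed disc of radius [r]. *)
Definition conv (r : R) (a : nat -> C) : Prop :=
  exists M, forall N, wnorm (fun n => r ^ n) a N <= M.

Lemma psum_is_pseries (a : nat -> C) (z l : C) :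
  Clim (psum a z) l <-> @is_pseries C_AbsRing C_NormedModule a z l.
Proof.
  assert (E : forall n,
    sum_n (fun k => scal (pow_n (K := C_AbsRing) z k) (a k : C_NormedModule)) n
                        = psum a z n).
  { intros n. apply sumC_ext. intros k _.
    replace (pow_n (K := C_AbsRing) z k) with (z ^ k)%C; [apply Cmult_comm|].
    induction k as [|k IH]; [easy|]. rewrite Cpow_S, IH. easy. }
  unfold is_pseries, is_series. split.
  - intros H P [eps HP].
    destruct (H eps (cond_pos eps)) as [N HN]. exists N. intros n Hn.
    apply HP. apply C_NormedModule_mixin_compat1. rewrite E. now apply HN.
  - intros H eps Heps.
    assert (Hs : 0 < sqrt 2) by (apply sqrt_lt_R0; lra).
    assert (He : 0 < eps / sqrt 2) by now apply Rdiv_lt_0_compat.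
    destruct (H _ (locally_ball l (mkposreal _ He))) as [N HN].
    exists N. intros n Hn. specialize (HN n Hn).
    rewrite <- E.
    apply C_NormedModule_mixin_compat2 in HN. simpl in HN.
    replace (sqrt 2 * (eps / sqrt 2)) with eps in HN by (field; lra). exact HN.
Qed.

Lemma ex_series_bounded_sums (f : nat -> R) (M : R) :
  (forall k, 0 <= f k) -> (forall N, sum_n f N <= M) -> ex_series f.
Proof.
  intros Hf HM. apply (ex_finite_lim_seq_incr _ M).
  - intros n. specialize (Hf (S n)). assert (E := sumR_S f n).
    change (sum_n f n <= sum_n f (S n)). lra.
  - exact HM.
Qed.

Lemma conv_ex_series (r : R) (a : nat -> C) (x : R) :
  conv r a -> 0 <= x <= r -> ex_series (fun n => Cmod (a n) * x ^ n).
Proof.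
  intros [M HM] Hx. apply (ex_series_bounded_sums _ M).
  - intros k. apply Rmult_le_pos; [apply Cmod_ge_0|apply pow_le; lra].
  - intros N. apply Rle_trans with (2 := HM N). apply sumR_le. intros k _.
    apply Rmult_le_compat_l; [apply Cmod_ge_0|]. now apply pow_incr.
Qed.

Lemma conv_Clim (r : R) (a : nat -> C) (z : C) :
  conv r a -> Cmod z <= r -> exists l, Clim (psum a z) l.
Proof.
  intros Ha Hz.
  assert (H := conv_ex_series r a (Cmod z) Ha (conj (Cmod_ge_0 z) Hz)).
  destruct (ex_series_le (V := C_CompleteNormedModule)
              (fun k => scal (pow_n (K := C_AbsRing) z k) (a k : C_NormedModule))
              (fun n => Cmod (a n) * Cmod z ^ n)) as [l Hl]; [|easy|].
  - intros n. apply Rle_trans with (1 := norm_scal _ _).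
    rewrite Rmult_comm. apply Rmult_le_compat_l; [apply Cmod_ge_0|].
    apply (abs_pow_n (K := C_AbsRing)).
  - exists l. now apply psum_is_pseries.
Qed.

Lemma psum_padd a b z n : psum (padd a b) z n = (psum a z n + psum b z n)%C.
Proof.
  unfold psum. rewrite <- sumC_plus. apply sumC_ext. intros k _.
  unfold padd. ring.
Qed.

Lemma psum_pscal c a z n : psum (pscal c a) z n = (c * psum a z n)%C.
Proof.
  unfold psum. rewrite <- sumC_mult_l. apply sumC_ext. intros k _.
  unfold pscal. ring.
Qed.

Lemma psum_pdil c a z n : psum (pdil c a) z n = psum a (c * z)%C n.
Proof.
  apply sumC_ext. intros k _. unfold pdil. rewrite Cpow_mult_l. ring.
Qed.

Lemma Cmod_psum a z n : Cmod (psum a z n) <= wnorm (fun k => Cmod z ^ k) a n.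
Proof.
  apply Rle_trans with (1 := Cmod_sum_n _ _). right. apply sumR_ext.
  intros k _. now rewrite Cmod_mult, Cmod_pow.
Qed.

Lemma conv_le (r r' : R) a : 0 <= r' <= r -> conv r a -> conv r' a.
Proof.
  intros Hr [M HM]. exists M. intros N. apply Rle_trans with (2 := HM N).
  apply sumR_le. intros k _.
  apply Rmult_le_compat_l; [apply Cmod_ge_0|]. now apply pow_incr.
Qed.

Lemma conv_padd r a b : 0 <= r -> conv r a -> conv r b -> conv r (padd a b).
Proof.
  intros Hr [A HA] [B HB]. exists (A + B). intros N.
  apply Rle_trans with (1 := wnorm_padd _ (weight_pow r Hr) a b N).
  specialize (HA N). specialize (HB N). lra.
Qed.

Lemma conv_pscal r c a : conv r a -> conv r (pscal c a).
Proof.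
  intros [A HA]. exists (Cmod c * A). intros N. rewrite wnorm_pscal.
  apply Rmult_le_compat_l; [apply Cmod_ge_0|apply HA].
Qed.

Lemma conv_pdil r c a : Cmod c = 1 -> conv r a -> conv r (pdil c a).
Proof.
  intros Hc [A HA]. exists A. intros N. rewrite wnorm_pdil by easy. apply HA.
Qed.

Lemma conv_pmul r a b : 0 <= r -> conv r a -> conv r b -> conv r (pmul a b).
Proof.
  intros Hr [A HA] [B HB]. exists (A * B). intros N.
  assert (HW := weight_pow r Hr).
  apply Rle_trans with (1 := wnorm_pmul _ HW a b N).
  apply Rmult_le_compat; try easy; apply wnorm_ge0, HW.
Qed.

Lemma conv_ppow r a m : 0 <= r -> conv r a -> conv r (ppow a m).
Proof.
  intros Hr [A HA]. exists (A ^ m). intros N. assert (HW := weight_pow r Hr).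
  apply Rle_trans with (1 := wnorm_ppow _ HW a m N).
  apply pow_incr. split; [apply wnorm_ge0, HW|apply HA].
Qed.

Lemma conv_pint r a : 0 <= r -> conv r a -> conv r (pint a).
Proof.
  intros Hr [A HA]. exists (r * A). intros N. assert (HW := weight_pow r Hr).
  apply Rle_trans with (r * wnorm (fun n => r ^ n) a N).
  - apply wnorm_pint; [easy..|]. intros n. simpl. lra.
  - apply Rmult_le_compat_l; [easy|apply HA].
Qed.

(** The linear term of the binomial expansion: the factor [S n] produced by differentiation is
    traded for a loss [h] of radius. *)
Lemma pow_tangent (rho h : R) (n : nat) : 0 <= rho -> 0 <= h ->
  INR (S n) * rho ^ n * h <= (rho + h) ^ S n.
Proof.
  intros Hr Hh. induction n as [|n IH]; [simpl; lra|].
  rewrite S_INR. change (rho ^ S n) with (rho * rho ^ n).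
  change ((rho + h) ^ S (S n)) with ((rho + h) * (rho + h) ^ S n).
  assert (H1 : rho ^ S n <= (rho + h) ^ S n) by (apply pow_incr; lra).
  change (rho ^ S n) with (rho * rho ^ n) in H1. nra.
Qed.

Lemma conv_pder (r rho : R) a : 0 <= rho < r -> conv r a -> conv rho (pder a).
Proof.
  intros Hr [M HM]. exists (M / (r - rho)). intros N.
  apply Rmult_le_reg_r with (r - rho); [lra|].
  unfold Rdiv. rewrite Rmult_assoc, Rinv_l, Rmult_1_r by lra.
  apply Rle_trans with (2 := HM (S N)).
  unfold wnorm. rewrite <- sumR_mult_r.
  assert (Hk : forall k, Cmod (pder a k) * rho ^ k * (r - rho)
                         <= Cmod (a (S k)) * r ^ S k).
  { intros k. unfold pder.
    rewrite Cmod_mult, Cmod_R, Rabs_pos_eq by apply pos_INR.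
    assert (T := pow_tangent rho (r - rho) k ltac:(lra) ltac:(lra)).
    replace (rho + (r - rho)) with r in T by ring.
    assert (H := Cmod_ge_0 (a (S k))). nra. }
  induction N as [|N IH].
  - rewrite sumR_S, !sum_O. specialize (Hk O).
    assert (H := Cmod_ge_0 (a O)). simpl (r ^ 0). lra.
  - rewrite (sumR_S _ (S N)).
    rewrite (sumR_S (fun k => Cmod (pder a k) * rho ^ k * (r - rho)) N).
    specialize (Hk (S N)). lra.
Qed.

Lemma sumC_tail (y : nat -> C) (m n : nat) : (m <= n)%nat ->
  Cmod (sum_n y n - sum_n y m)%C
  <= sum_n (fun k => Cmod (y k)) n - sum_n (fun k => Cmod (y k)) m.
Proof.
  intros H. induction H as [|n H IH].
  - rewrite Rminus_diag. right.
    replace (sum_n y m - sum_n y m)%C with (RtoC 0) by ring. apply Cmod_0.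
  - rewrite sumC_S, sumR_S.
    replace (sum_n y n + y (S n) - sum_n y m)%C
      with ((sum_n y n - sum_n y m) + y (S n))%C by ring.
    apply Rle_trans with (1 := Cmod_triangle _ _). lra.
Qed.

Lemma psum_pmul_convolution a b z n :
  psum (pmul a b) z n
  = sum_n (fun k => a k * z ^ k * psum b z (n - k)%nat)%C n.
Proof.
  transitivity (sum_n (fun m => sum_n (fun k =>
      (a k * z ^ k) * (b (m - k)%nat * z ^ (m - k)))%C m) n);
    [|exact (sumC_convolution (fun k => a k * z ^ k)%C
               (fun k => b k * z ^ k)%C n)].
  apply sumC_ext. intros m _. unfold pmul. rewrite Cmult_comm.
  rewrite <- sumC_mult_l. apply sumC_ext. intros k Hk.
  change (z ^ m * (a k * b (m - k)%nat)
          = a k * z ^ k * (b (m - k)%nat * z ^ (m - k)))%C.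
  replace m with (k + (m - k))%nat at 1 by lia. rewrite Cpow_add_r. ring.
Qed.

(** The gap between the partial sum of the product and the product of the partial sums is dominated
    by the same gap [E] for absolute values, which vanishes in the limit by the Cauchy product
    theorem for real series. *)
Lemma Clim_psum_pmul r a b z la lb :
  conv r a -> conv r b -> Cmod z <= r ->
  Clim (psum a z) la -> Clim (psum b z) lb ->
  Clim (psum (pmul a b) z) (la * lb)%C.
Proof.
  intros Ha Hb Hz Hla Hlb.
  set (x := fun k => Cmod (a k) * Cmod z ^ k).
  set (y := fun k => Cmod (b k) * Cmod z ^ k).
  assert (Hz' := conj (Cmod_ge_0 z) Hz).
  destruct (conv_ex_series r a _ Ha Hz') as [lx Hx]. fold x in Hx.
  destruct (conv_ex_series r b _ Hb Hz') as [ly Hy]. fold y in Hy.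
  assert (Hpos : forall c k, 0 <= Cmod c * Cmod z ^ k).
  { intros c k. apply Rmult_le_pos; [apply Cmod_ge_0|apply pow_le, Cmod_ge_0]. }
  assert (Hxy : is_series (fun n => sum_n (fun k => x k * y (n - k)%nat) n) (lx * ly)).
  { apply is_series_ext with (fun n => sum_f_R0 (fun k => x k * y (n - k)%nat) n).
    - intros n. now rewrite sum_n_Reals.
    - apply is_series_mult; [easy..| |].
      + exists lx. apply is_series_ext with x; [|easy]. intros n.
        now rewrite Rabs_pos_eq by apply Hpos.
      + exists ly. apply is_series_ext with y; [|easy]. intros n.
        now rewrite Rabs_pos_eq by apply Hpos. }
  set (E := fun n => sum_n x n * sum_n y n
             - sum_n (fun n => sum_n (fun k => x k * y (n - k)%nat) n) n).
  assert (HE : is_lim_seq E 0).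
  { replace (Finite 0) with (Finite (lx * ly - lx * ly)) by (f_equal; ring).
    apply is_lim_seq_minus'; [|exact Hxy].
    apply is_lim_seq_mult'; [exact Hx|exact Hy]. }
  assert (Hdiff : Clim (fun n => (psum (pmul a b) z n - psum a z n * psum b z n)%C) 0).
  { apply (Clim_squeeze _ _ E); [|exact HE]. intros n. unfold E.
    rewrite (sumR_convolution x y), psum_pmul_convolution.
    replace (sum_n (fun k => a k * z ^ k * psum b z (n - k)%nat)%C n
             - psum a z n * psum b z n - 0)%C
      with (sum_n (fun k => a k * z ^ k * (psum b z (n - k)%nat - psum b z n))%C n).
    2:{ change (psum a z n) with (sum_n (fun k => a k * z ^ k)%C n).
        rewrite <- sumC_mult_r.
        rewrite (sumC_ext _ (fun k => a k * z ^ k * psum b z (n - k)%nat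
                   - a k * z ^ k * psum b z n)%C) by (intros; ring).
        rewrite sumC_minus.
        cut (forall u v : C, (u - v = u - v - 0)%C); [easy|]. intros; ring. }
    apply Rle_trans with (1 := Cmod_sum_n _ _).
    rewrite <- (sumR_mult_r (sum_n y n) x).
    rewrite <- sumR_minus.
    rewrite (sumR_ext (fun k => x k * sum_n y n - _)
               (fun k => x k * (sum_n y n - sum_n y (n - k)%nat))) by (intros; ring).
    apply sumR_le. intros k Hk. rewrite Cmod_mult, Cmod_mult, Cmod_pow.
    apply Rmult_le_compat_l; [apply Hpos|].
    rewrite <- Cmod_opp, Copp_minus_distr.
    assert (Ey : forall m, sum_n (fun k => Cmod (b k * z ^ k)%C) m = sum_n y m).
    { intros m. apply sumR_ext. intros j _. now rewrite Cmod_mult, Cmod_pow. }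
    rewrite <- !Ey.
    exact (sumC_tail (fun k => b k * z ^ k)%C (n - k) n ltac:(lia)). }
  replace (la * lb)%C with (0 + la * lb)%C by ring.
  apply Clim_ext with (fun n => (psum (pmul a b) z n - psum a z n * psum b z n)
                                + psum a z n * psum b z n)%C.
  - intros n. ring.
  - apply Clim_plus; [exact Hdiff|now apply Clim_mult].
Qed.

Lemma Clim_psum_ppow r a z l m : conv r a -> Cmod z <= r ->
  Clim (psum a z) l -> Clim (psum (ppow a m) z) (l ^ m)%C.
Proof.
  intros Ha Hz Hl. induction m as [|m IH].
  - apply Clim_ext with (2 := Clim_const 1%C). intros n. unfold psum.
    induction n as [|n IH]; [rewrite sum_O; simpl; ring|].
    rewrite sumC_S, <- IH. simpl ppow. rewrite Cmult_0_l. ring.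
  - rewrite Cpow_S. apply (Clim_psum_pmul r); try easy.
    apply conv_ppow; [|easy]. apply Rle_trans with (2 := Hz), Cmod_ge_0.
Qed.

(* Tannery's theorem. *)
Lemma is_lim_seq_tannery (f : nat -> nat -> R) (g : nat -> R) :
  (forall m n, 0 <= f m n <= g m) -> ex_series g ->
  (forall m, is_lim_seq (f m) 0) ->
  is_lim_seq (fun n => sum_n (fun m => f m n) n) 0.
Proof.
  intros Hfg [G HG] Hf.
  assert (Hfin : forall M, is_lim_seq (fun n => sum_n (fun m => f m n) M) 0).
  { induction M as [|M IH].
    - apply is_lim_seq_ext with (f O); [intros n; now rewrite sum_O|apply Hf].
    - apply is_lim_seq_ext with (fun n => sum_n (fun m => f m n) M + f (S M) n).
      + intros n. now rewrite sumR_S.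
      + replace (Finite 0) with (Finite (0 + 0)) by (f_equal; ring).
        now apply is_lim_seq_plus'. }
  assert (Hdom : forall M n, (M <= n)%nat ->
    sum_n (fun m => f m n) n <= sum_n (fun m => f m n) M + (sum_n g n - sum_n g M)).
  { intros M n Hn.
    assert (H : forall k, (M <= k)%nat -> sum_n (fun m => f m n) k
               <= sum_n (fun m => f m n) M + (sum_n g k - sum_n g M)); [|now apply H].
    intros k Hk. induction Hk as [|k Hk IH]; [lra|].
    rewrite !sumR_S. destruct (Hfg (S k) n). lra. }
  apply is_lim_seq_spec. intros eps.
  assert (HG' : is_lim_seq (sum_n g) G) by exact HG.
  apply is_lim_seq_spec in HG'.
  destruct (HG' (mkposreal (eps / 4) ltac:(destruct eps; simpl; lra))) as [M HM].
  simpl in HM.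
  assert (HfM := Hfin M). apply is_lim_seq_spec in HfM.
  destruct (HfM (pos_div_2 eps)) as [N HN]. simpl in HN.
  exists (Nat.max M N). intros n Hn.
  specialize (HN n ltac:(lia)). rewrite Rminus_0_r in *.
  assert (H1 := HM M (le_n M)). assert (H2 := HM n ltac:(lia)).
  assert (H0 : 0 <= sum_n (fun m => f m n) n) by (apply sumR_ge0; intros; apply Hfg).
  rewrite Rabs_pos_eq by easy. specialize (Hdom M n ltac:(lia)).
  apply Rabs_def2 in H1, H2, HN. lra.
Qed.

(** Powers [m > k] have no term of degree [k], so the triangular sum may be completed to a square
    and its order exchanged. *)
Lemma psum_pcomp p a z n : a O = RtoC 0 ->
  psum (pcomp p a) z n = sum_n (fun m => p m * psum (ppow a m) z n)%C n.
Proof.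
  intros Ha.
  transitivity (sum_n (fun k => sum_n (fun m => p m * (ppow a m k * z ^ k))%C n) n).
  - apply sumC_ext. intros k Hk. unfold pcomp. rewrite <- sumC_mult_r.
    rewrite (sumC_ext _ (fun m => p m * (ppow a m k * z ^ k))%C) by (intros; ring).
    induction Hk as [|n Hk IH]; [easy|].
    rewrite sumC_S, <- IH, ppow_valuation by (easy || lia).
    cut (forall u v w : C, u = u + v * (0 * w))%C; [easy|]. intros; ring.
  - rewrite sum_n_switch. apply sumC_ext. intros m _. now rewrite sumC_mult_l.
Qed.

(** The partial sums of the [m]-th power tend to [la ^ m] and are bounded by [s ^ m] uniformly in
    [n]; Tannery's theorem then applies with majorant [2 |p m| s ^ m]. *)
Lemma Clim_psum_pcomp (rho s : R) p a z la lp :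
  conv rho p -> a O = RtoC 0 ->
  (forall N, wnorm (fun n => Cmod z ^ n) a N <= s) -> s <= rho ->
  Clim (psum a z) la -> Clim (psum p la) lp ->
  Clim (psum (pcomp p a) z) lp.
Proof.
  intros Hp Ha Hs Hrho Hla Hlp.
  assert (HW := weight_pow (Cmod z) (Cmod_ge_0 z)).
  assert (Hs0 : 0 <= s).
  { apply Rle_trans with (2 := Hs O). now apply wnorm_ge0. }
  assert (Hpow : forall m n, Cmod (psum (ppow a m) z n) <= s ^ m).
  { intros m n. apply Rle_trans with (1 := Cmod_psum _ _ _).
    apply Rle_trans with (1 := wnorm_ppow _ HW a m n).
    apply pow_incr. split; [now apply wnorm_ge0|apply Hs]. }
  assert (Hpowl : forall m, Clim (psum (ppow a m) z) (la ^ m)%C).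
  { intros m. apply (Clim_psum_ppow (Cmod z)); [now exists s|lra|easy]. }
  set (f := fun m n => Cmod (p m) * Cmod (psum (ppow a m) z n - la ^ m)%C).
  assert (Hf : is_lim_seq (fun n => sum_n (fun m => f m n) n) 0).
  { apply (is_lim_seq_tannery f (fun m => 2 * (Cmod (p m) * s ^ m))).
    - intros m n. unfold f. split.
      + apply Rmult_le_pos; apply Cmod_ge_0.
      + assert (T := Cmod_triangle (psum (ppow a m) z n) (- la ^ m)%C).
        rewrite Cmod_opp in T. specialize (Hpow m n) as H1.
        assert (H2 := Clim_bound _ _ _ (Hpow m) (Hpowl m)).
        assert (H3 := Cmod_ge_0 (p m)). unfold Cminus. nra.
    - apply (ex_series_scal_l (K := R_AbsRing) (V := R_NormedModule) 2
               (fun m => Cmod (p m) * s ^ m)).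
      now apply (conv_ex_series rho).
    - intros m. replace (Finite 0) with (Finite (Cmod (p m) * 0)) by (f_equal; ring).
      apply (is_lim_seq_scal_l _ _ 0), Clim_is_lim_seq, Hpowl. }
  assert (Hdiff : Clim (fun n => psum (pcomp p a) z n - psum p la n)%C 0).
  { apply (Clim_squeeze _ _ _) with (2 := Hf). intros n.
    rewrite psum_pcomp by easy. unfold psum at 2.
    rewrite <- sumC_minus.
    replace (_ - 0)%C with (sum_n (fun m => p m * (psum (ppow a m) z n - la ^ m)) n)%C.
    - apply Rle_trans with (1 := Cmod_sum_n _ _). right. apply sumR_ext.
      intros m _. now rewrite Cmod_mult.
    - rewrite (sumC_ext _ (fun m => p m * psum (ppow a m) z n - p m * la ^ m)%C)
        by (intros; ring).
      cut (forall u : C, (u = u - 0)%C); [easy|]. intros; ring. }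
  replace lp with (0 + lp)%C by ring.
  apply Clim_ext with (fun n => (psum (pcomp p a) z n - psum p la n) + psum p la n)%C.
  - intros n. ring.
  - now apply Clim_plus.
Qed.

(** * Evaluation and termwise differentiation *)

(** The dependence on [n] is only through [(rho + h) ^ n], so the remainders can be summed against
    coefficients that converge at radius [rho + h]. *)
Lemma Cpow_taylor_remainder (z w : C) (rho h : R) (n : nat) :
  Cmod z <= rho -> 0 < h -> Cmod (w - z)%C <= h / 2 ->
  Cmod (w ^ n - z ^ n - RtoC (INR n) * z ^ pred n * (w - z))%C
  <= 2 * (Cmod (w - z)%C / h) ^ 2 * (rho + h) ^ n.
Proof.
  intros Hz Hh Hd. set (d := Cmod (w - z)%C) in *.
  assert (Hd0 : 0 <= d) by apply Cmod_ge_0.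
  assert (Hr0 : 0 <= rho) by (apply Rle_trans with (2 := Hz), Cmod_ge_0).
  set (e := (d / h) ^ 2).
  assert (He0 : 0 <= e) by apply pow2_ge_0.
  assert (Hde : d * d = e * h * h) by (unfold e; field; lra).
  induction n as [|n IH].
  - replace (w ^ 0 - z ^ 0 - RtoC (INR 0) * z ^ pred 0 * (w - z))%C with (RtoC 0)
      by (simpl; ring).
    rewrite Cmod_0. simpl. lra.
  - replace (w ^ S n - z ^ S n - RtoC (INR (S n)) * z ^ pred (S n) * (w - z))%C
      with (w * (w ^ n - z ^ n - RtoC (INR n) * z ^ pred n * (w - z))
            + RtoC (INR n) * z ^ pred n * ((w - z) * (w - z)))%C.
    2:{ rewrite S_INR, RtoC_plus, !Cpow_S. simpl pred. destruct n as [|n].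
        - simpl. ring.
        - rewrite !Cpow_S. simpl pred. ring. }
    set (X := (rho + h) ^ n).
    assert (HX : INR n * rho ^ pred n * h <= X).
    { unfold X. destruct n as [|n]; [simpl; lra|].
      apply pow_tangent; lra. }
    assert (HX0 : 0 <= X) by (apply pow_le; lra).
    assert (Hw : Cmod w <= rho + d).
    { replace w with (z + (w - z))%C by ring.
      apply Rle_trans with (1 := Cmod_triangle _ _). fold d. lra. }
    assert (Hzp : Cmod z ^ pred n <= rho ^ pred n).
    { apply pow_incr. split; [apply Cmod_ge_0|easy]. }
    apply Rle_trans with (1 := Cmod_triangle _ _).
    rewrite Cmod_mult, !(Cmod_mult _ ((w - z) * (w - z))), (Cmod_mult (w - z)), Cmod_mult,
      Cmod_pow, Cmod_R, Rabs_pos_eq by apply pos_INR.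
    fold d. fold X in IH.
    apply Rle_trans with ((rho + d) * (2 * e * X) + INR n * rho ^ pred n * (d * d)).
    + apply Rplus_le_compat.
      * apply Rmult_le_compat; try apply Cmod_ge_0; easy.
      * apply Rmult_le_compat_r; [nra|].
        apply Rmult_le_compat_l; [apply pos_INR|easy].
    + rewrite Hde. change ((rho + h) ^ S n) with ((rho + h) * X).
      replace (INR n * rho ^ pred n * (e * h * h))
        with (e * h * (INR n * rho ^ pred n * h)) by ring.
      apply Rle_trans with ((rho + d) * (2 * e * X) + e * h * X).
      * apply Rplus_le_compat_l, Rmult_le_compat_l; [nra|easy].
      (* The constant 2 closes the induction because [d <= h / 2] gives
         [2 * (rho + d) + h <= 2 * (rho + h)]. *)
      * assert (0 <= e * X) by nra. nra.
Qed.

(** Total by choice; the value is meaningful only where the partial sums converge. *)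
Definition ev (a : nat -> C) (z : C) : C :=
  epsilon (inhabits (RtoC 0)) (Clim (psum a z)).

Lemma ev_unique a z l : Clim (psum a z) l -> ev a z = l.
Proof.
  intros H. apply (Clim_unique (psum a z)); [|easy].
  exact (epsilon_spec _ (Clim (psum a z)) (ex_intro _ l H)).
Qed.

Lemma ev_Clim r a z : conv r a -> Cmod z <= r -> Clim (psum a z) (ev a z).
Proof.
  intros Ha Hz.
  exact (epsilon_spec _ (Clim (psum a z)) (conv_Clim r a z Ha Hz)).
Qed.

Lemma psum_remainder a z w N :
  (psum a w (S N) - psum a z (S N) - (w - z) * psum (pder a) z N)%C
  = sum_n (fun n => a n * (w ^ n - z ^ n - RtoC (INR n) * z ^ pred n * (w - z)))%C (S N).
Proof.
  induction N as [|N IH].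
  - unfold psum, pder. rewrite !sumC_S, !sum_O. simpl. ring.
  - rewrite (sumC_S _ (S N)), <- IH. unfold psum.
    rewrite !(sumC_S _ (S N)), (sumC_S (fun k => pder a k * z ^ k)%C N).
    unfold pder at 2. simpl pred.
    set (A := sum_n _ (S N)). set (B := sum_n _ (S N)). set (D := sum_n _ N).
    change (A + a (S (S N)) * w ^ S (S N) - (B + a (S (S N)) * z ^ S (S N))
      - (w - z) * (D + RtoC (INR (S (S N))) * a (S (S N)) * z ^ S N)
      = A - B - (w - z) * D + a (S (S N)) * (w ^ S (S N) - z ^ S (S N)
         - RtoC (INR (S (S N))) * z ^ S N * (w - z)))%C.
    generalize (RtoC (INR (S (S N)))). intros. ring.
Qed.

(** The summed Taylor remainders bound the partial sums quadratically in [|w - z|], uniformly in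
    [N], and the bound passes to the limit. *)
Lemma is_derive_ev r a z : conv r a -> Cmod z < r ->
  @is_derive C_AbsRing (AbsRing_NormedModule C_AbsRing) (ev a) z (ev (pder a) z).
Proof.
  intros Ha Hz. destruct Ha as [M HM].
  assert (Ha : conv r a) by now exists M.
  assert (Hz0 := Cmod_ge_0 z).
  set (h := r - Cmod z). assert (Hh : 0 < h) by (unfold h; lra).
  assert (Hbound : forall w, Cmod (w - z)%C <= h / 2 ->
    Cmod (ev a w - ev a z - (w - z) * ev (pder a) z)%C
    <= 2 * (Cmod (w - z)%C / h) ^ 2 * M).
  { intros w Hw.
    assert (Hwr : Cmod w <= r).
    { replace w with (z + (w - z))%C by ring.
      apply Rle_trans with (1 := Cmod_triangle _ _). unfold h in *. lra. }
    assert (Hder : conv (Cmod z) (pder a)) by (apply (conv_pder r); [lra|easy]).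
    apply (Clim_bound (fun N => psum a w (S N) - psum a z (S N)
                                - (w - z) * psum (pder a) z N)%C).
    - intros N. rewrite psum_remainder.
      apply Rle_trans with (1 := Cmod_sum_n _ _).
      apply Rle_trans with (2 * (Cmod (w - z)%C / h) ^ 2 * wnorm (fun n => r ^ n) a (S N)).
      + unfold wnorm. rewrite <- sumR_mult_l. apply sumR_le. intros k _.
        rewrite Cmod_mult.
        assert (T := Cpow_taylor_remainder z w (Cmod z) h k (Rle_refl _) Hh Hw).
        replace (Cmod z + h) with r in T by (unfold h; ring).
        assert (H := Cmod_ge_0 (a k)). nra.
      + apply Rmult_le_compat_l; [|apply HM].
        apply Rmult_le_pos; [lra|apply pow2_ge_0].
    - assert (H1 := ev_Clim r a w Ha Hwr).
      assert (H2 := ev_Clim r a z Ha ltac:(lra)).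
      assert (H3 := ev_Clim (Cmod z) (pder a) z Hder (Rle_refl _)).
      replace (ev a w - ev a z - (w - z) * ev (pder a) z)%C
        with (ev a w + (-1) * ev a z + (-1 * (w - z)) * ev (pder a) z)%C by ring.
      apply Clim_ext with (fun N => psum a w (S N) + (-1) * psum a z (S N)
                              + (-1 * (w - z)) * psum (pder a) z N)%C;
        [intros; ring|].
      apply Clim_plus; [apply Clim_plus|].
      + now apply (Clim_S (psum a w)).
      + now apply Clim_mult_l, (Clim_S (psum a z)).
      + now apply Clim_mult_l. }
  assert (HM0 : 0 <= M).
  { apply Rle_trans with (2 := HM O). apply wnorm_ge0, weight_pow. lra. }
  split; [apply is_linear_scal_l|].
  intros x Hx eps.
  replace x with z by exact (is_filter_lim_locally_unique
    (V := AbsRing_NormedModule C_AbsRing) z x Hx).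
  clear x Hx.
  (* The first entry allows the Taylor bound, the second makes [2 * d * M / (h * h)] at most [eps];
     [M + 1] avoids a zero denominator. *)
  set (delta := Rmin (h / 2) (eps * (h * h) / (2 * (M + 1)))).
  assert (Hdelta : 0 < delta).
  { apply Rmin_pos; [lra|]. apply Rdiv_lt_0_compat; [|lra].
    apply Rmult_lt_0_compat; [apply cond_pos|nra]. }
  exists (mkposreal delta Hdelta). intros w Hw.
  change (Cmod (w - z)%C < delta) in Hw.
  change (Cmod (ev a w - ev a z - (w - z) * ev (pder a) z)%C <= eps * Cmod (w - z)%C).
  set (d := Cmod (w - z)%C) in *.
  assert (Hd0 : 0 <= d) by apply Cmod_ge_0.
  assert (Hd1 : d <= h / 2) by (apply Rlt_le, Rlt_le_trans with (1 := Hw), Rmin_l).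
  assert (Hd2 : d <= eps * (h * h) / (2 * (M + 1)))
    by (apply Rlt_le, Rlt_le_trans with (1 := Hw), Rmin_r).
  apply Rle_trans with (1 := Hbound w Hd1). fold d.
  replace (2 * (d / h) ^ 2 * M) with (2 * d * M / (h * h) * d) by (field; lra).
  apply Rmult_le_compat_r; [easy|].
  apply Rmult_le_reg_r with (h * h); [nra|].
  unfold Rdiv at 1. rewrite Rmult_assoc, Rinv_l, Rmult_1_r by nra.
  apply Rle_trans with (2 * (M + 1) * d); [nra|].
  apply Rmult_le_compat_l with (r := 2 * (M + 1)) in Hd2; [|lra].
  replace (2 * (M + 1) * (eps * (h * h) / (2 * (M + 1)))) with (eps * (h * h)) in Hd2
    by (field; lra).
  lra.
Qed.

Lemma ev_ext a b z : (forall n, a n = b n) -> conv (Cmod z) a -> ev a z = ev b z.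
Proof.
  intros E Ha. symmetry. apply ev_unique.
  apply Clim_ext with (psum a z); [|now apply (ev_Clim (Cmod z)); [|lra]].
  intros n. apply sumC_ext. intros k _. now rewrite E.
Qed.

Lemma ev_0 a : ev a 0 = a O.
Proof.
  apply ev_unique. apply Clim_ext with (2 := Clim_const (a O)). intros n.
  unfold psum. induction n as [|n IH]; [rewrite sum_O; simpl; ring|].
  rewrite sumC_S, <- IH, Cpow_S. ring.
Qed.

Lemma ev_padd a b z : conv (Cmod z) a -> conv (Cmod z) b ->
  ev (padd a b) z = (ev a z + ev b z)%C.
Proof.
  intros Ha Hb. apply ev_unique.
  apply Clim_ext with (fun n => psum a z n + psum b z n)%C.
  - intros n. now rewrite psum_padd.
  - apply Clim_plus; apply (ev_Clim (Cmod z)); easy || lra.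
Qed.

Lemma ev_pscal c a z : conv (Cmod z) a -> ev (pscal c a) z = (c * ev a z)%C.
Proof.
  intros Ha. apply ev_unique.
  apply Clim_ext with (fun n => c * psum a z n)%C.
  - intros n. now rewrite psum_pscal.
  - apply Clim_mult_l, (ev_Clim (Cmod z)); easy || lra.
Qed.

Lemma ev_pdil c a z : conv (Cmod (c * z)%C) a -> ev (pdil c a) z = ev a (c * z)%C.
Proof.
  intros Ha. apply ev_unique.
  apply Clim_ext with (psum a (c * z)%C).
  - intros n. now rewrite psum_pdil.
  - apply (ev_Clim (Cmod (c * z)%C)); easy || lra.
Qed.

Lemma ev_pmul a b z : conv (Cmod z) a -> conv (Cmod z) b ->
  ev (pmul a b) z = (ev a z * ev b z)%C.
Proof.
  intros Ha Hb. apply ev_unique.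
  apply (Clim_psum_pmul (Cmod z)); try easy; try lra;
    apply (ev_Clim (Cmod z)); easy || lra.
Qed.

Lemma Cmod_ev_le a z s :
  (forall N, wnorm (fun n => Cmod z ^ n) a N <= s) -> Cmod (ev a z) <= s.
Proof.
  intros H. apply (Clim_bound (psum a z)).
  - intros n. apply Rle_trans with (1 := Cmod_psum _ _ _). apply H.
  - apply (ev_Clim (Cmod z)); [now exists s|lra].
Qed.

Lemma ev_pcomp rho p a z : conv rho p -> a O = RtoC 0 ->
  (forall N, wnorm (fun n => Cmod z ^ n) a N <= rho) ->
  ev (pcomp p a) z = ev p (ev a z).
Proof.
  intros Hp Ha Hrho. apply ev_unique.
  apply (Clim_psum_pcomp rho rho p a z (ev a z)); try easy; try lra.
  - apply (ev_Clim (Cmod z)); [now exists rho|lra].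
  - apply (ev_Clim rho); [easy|]. now apply Cmod_ev_le.
Qed.

Lemma conv_pcomp r rho p a : 0 <= r -> conv rho p ->
  (forall N, wnorm (fun n => r ^ n) a N <= rho) -> conv r (pcomp p a).
Proof.
  intros Hr [P HP] Ha. exists P. intros N.
  apply Rle_trans with (2 := HP N). apply wnorm_pcomp; [now apply weight_pow|easy].
Qed.

(** * Functions analytic near the origin and their series *)

Lemma Cminus_0_r (z : C) : (z - 0)%C = z.
Proof. ring. Qed.

Lemma locally_0_Cmod (P : C -> Prop) :
  locally (RtoC 0) P <-> exists d, 0 < d /\ forall z, Cmod z < d -> P z.
Proof.
  split.
  - intros [d Hd]. exists d. split; [apply cond_pos|]. intros z Hz. apply Hd.
    apply C_NormedModule_mixin_compat1.
    change (Cmod (z - 0)%C < d). now rewrite Cminus_0_r.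
  - intros [d [Hd HP]].
    assert (Hs : 0 < sqrt 2) by (apply sqrt_lt_R0; lra).
    assert (He : 0 < d / sqrt 2) by now apply Rdiv_lt_0_compat.
    exists (mkposreal _ He). intros z Hz. apply HP.
    apply C_NormedModule_mixin_compat2 in Hz. simpl in Hz.
    replace (sqrt 2 * (d / sqrt 2)) with d in Hz by (field; lra).
    change (Cmod (z - 0)%C < d) in Hz. now rewrite Cminus_0_r in Hz.
Qed.

(** Abel's lemma: convergence at [x] bounds the terms there by [D], and at [x / 2] they are
    dominated by a geometric series. *)
Lemma Clim_psum_conv (a : nat -> C) (x : R) (l : C) :
  0 < x -> Clim (psum a (RtoC x)) l -> conv (x / 2) a.
Proof.
  intros Hx H.
  destruct (filterlim_bounded (K := R_AbsRing) (V := R_NormedModule)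
              (fun n => Cmod (psum a x n - l)%C)) as [B HB].
  { exists 0. exact (Clim_is_lim_seq _ _ H). }
  assert (HB' : forall n, Cmod (psum a x n - l)%C <= B).
  { intros n. apply Rle_trans with (2 := HB n). apply Rle_abs. }
  assert (HB0 : 0 <= B) by (apply Rle_trans with (2 := HB' O), Cmod_ge_0).
  set (D := 2 * B + Cmod (a O)).
  assert (Hterm : forall n, Cmod (a n) * x ^ n <= D).
  { intros [|n].
    - simpl. unfold D. lra.
    - replace (Cmod (a (S n)) * x ^ S n)
        with (Cmod ((psum a x (S n) - l) - (psum a x n - l))%C).
      + apply Rle_trans with (1 := Cmod_triangle _ _). rewrite Cmod_opp.
        assert (H1 := HB' (S n)). assert (H2 := HB' n).
        assert (H3 := Cmod_ge_0 (a O)). unfold D. lra.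
      + unfold psum at 1. rewrite sumC_S. fold (psum a x n).
        replace (psum a x n + a (S n) * x ^ S n - l - (psum a x n - l))%C
          with (a (S n) * x ^ S n)%C by ring.
        rewrite Cmod_mult, Cmod_pow, Cmod_R, Rabs_pos_eq by lra. easy. }
  exists (2 * D). intros N.
  (* The exact geometric partial sum, as the induction needs. *)
  cut (wnorm (fun n => (x / 2) ^ n) a N <= D * (2 - (/ 2) ^ N)).
  { assert (0 < (/ 2) ^ N) by (apply pow_lt; lra).
    assert (0 <= D) by (unfold D; assert (H3 := Cmod_ge_0 (a O)); lra). nra. }
  assert (Hk : forall k, Cmod (a k) * (x / 2) ^ k <= D * (/ 2) ^ k).
  { intros k. unfold Rdiv. rewrite Rpow_mult_distr, <- Rmult_assoc.
    apply Rmult_le_compat_r; [apply pow_le; lra|apply Hterm]. }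
  unfold wnorm. induction N as [|N IH].
  - rewrite sum_O. specialize (Hk O). simpl in *. lra.
  - rewrite sumR_S. specialize (Hk (S N)). simpl in *. lra.
Qed.

Lemma expands_near0_conv (f : C -> C) (a : nat -> C) : expands_near0 f a ->
  exists r, 0 < r /\ conv r a /\ forall z, Cmod z < r -> f z = ev a z.
Proof.
  intros H. apply locally_0_Cmod in H. destruct H as [d [Hd H]].
  assert (Hx : Cmod (d / 2)%R < d) by (rewrite Cmod_R, Rabs_pos_eq; lra).
  (* One halving picks a point inside the neighborhood, the other is the loss in Abel's lemma. *)
  exists (d / 2 / 2). repeat split.
  - lra.
  - apply (Clim_psum_conv a _ (f (d / 2)%R)); [lra|].
    apply psum_is_pseries, H, Hx.
  - intros z Hz. symmetry. apply ev_unique, psum_is_pseries, H. lra.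
Qed.

Lemma expands_near0_ev (r : R) (a : nat -> C) :
  0 < r -> conv r a -> expands_near0 (ev a) a.
Proof.
  intros Hr Ha. apply locally_0_Cmod. exists r. split; [easy|].
  intros z Hz. apply psum_is_pseries, (ev_Clim r); [easy|lra].
Qed.

Lemma locally_Cmod_lt (z : C) (r : R) : Cmod z < r ->
  @locally (AbsRing_UniformSpace C_AbsRing) z (fun w => Cmod w < r).
Proof.
  intros Hz. assert (Hd : 0 < r - Cmod z) by lra.
  exists (mkposreal _ Hd). intros w Hw. change (Cmod (w - z)%C < r - Cmod z) in Hw.
  replace w with (z + (w - z))%C by ring.
  apply Rle_lt_trans with (1 := Cmod_triangle _ _). lra.
Qed.

Lemma is_derive_near_ev (r : R) (f : C -> C) (a : nat -> C) (z : C) :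
  conv r a -> (forall w, Cmod w < r -> f w = ev a w) -> Cmod z < r ->
  @is_derive C_AbsRing (AbsRing_NormedModule C_AbsRing) f z (ev (pder a) z).
Proof.
  intros Ha Hf Hz. apply (is_derive_ext_loc (V := AbsRing_NormedModule C_AbsRing) (ev a)).
  - apply filter_imp with (2 := locally_Cmod_lt z r Hz). intros w Hw.
    symmetry. now apply Hf.
  - now apply (is_derive_ev r).
Qed.

(** The two normed module structures on [C] have convertible domination clauses, so only linearity
    is proved again. *)
Lemma is_derive_AbsRing_C_derive (f : C -> C) (z l : C) :
  @is_derive C_AbsRing (AbsRing_NormedModule C_AbsRing) f z l -> C_derive f z = l.
Proof.
  intros [_ H]. apply is_C_derive_unique. split; [apply is_linear_scal_l|exact H].
Qed.

Lemma C_derive_near_ev (r : R) (f : C -> C) (a : nat -> C) (z : C) :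
  conv r a -> (forall w, Cmod w < r -> f w = ev a w) -> Cmod z < r ->
  C_derive f z = ev (pder a) z.
Proof.
  intros Ha Hf Hz. apply is_derive_AbsRing_C_derive. now apply (is_derive_near_ev r).
Qed.

Lemma C_derive2_near_ev (r r' : R) (f : C -> C) (a : nat -> C) (z : C) :
  conv r a -> (forall w, Cmod w < r -> f w = ev a w) ->
  0 <= r' < r -> Cmod z < r' ->
  C_derive (C_derive f) z = ev (pder (pder a)) z.
Proof.
  intros Ha Hf Hr Hz. apply (C_derive_near_ev r').
  - now apply (conv_pder r).
  - intros w Hw. apply (C_derive_near_ev r); try easy. lra.
  - easy.
Qed.

(** * The formal solution *)

Fixpoint picard (T : (nat -> C) -> nat -> C) (k : nat) : nat -> C :=
  match k with O => fun _ => RtoC 0 | S k => T (picard T k) end.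

(** By causality the [k]-th iterate is final below degree [k], so the diagonal is a fixed point
    without any contraction. A norm truncated at [N] sees only the iterate [S N], so the bound
    carries over. *)
Lemma causal_fixpoint (T : (nat -> C) -> nat -> C) (W : nat -> R) (M : R) :
  (forall n u v, agree n u v -> agree (S n) (T u) (T v)) ->
  weight W -> 0 <= M ->
  (forall u, (forall N, wnorm W u N <= M) -> forall N, wnorm W (T u) N <= M) ->
  exists u, (forall n, T u n = u n) /\ (forall N, wnorm W u N <= M).
Proof.
  intros HT HW HM HB.
  assert (H1 : forall k, agree k (picard T k) (picard T (S k))).
  { induction k as [|k IH]; [intros j Hj; lia|]. now apply HT. }
  assert (H2 : forall k m, (k <= m)%nat -> agree k (picard T k) (picard T m)).
  { intros k m Hkm. induction Hkm as [|m Hkm IH]; [easy|].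
    intros j Hj. rewrite IH by easy. apply H1. lia. }
  set (u := fun n => picard T (S n) n).
  assert (H3 : forall k, agree k (picard T k) u).
  { intros k j Hj. symmetry. apply (H2 (S j)); lia. }
  exists u. split.
  - intros n. transitivity (T (picard T (S n)) n).
    + symmetry. apply (HT (S n)); [apply H3|lia].
    + symmetry. apply (H1 (S n)). lia.
  - intros N. rewrite <- (wnorm_agree W _ _ N (H3 (S N))).
    revert N. assert (H4 : forall k N, wnorm W (picard T k) N <= M); [|easy].
    induction k as [|k IH]; [|now apply HB].
    intros N. apply Rle_trans with 0; [|easy]. right.
    induction N as [|N IH].
    + unfold wnorm. rewrite sum_O. simpl. rewrite Cmod_0. ring.
    + unfold wnorm in *. rewrite sumR_S, IH. simpl. rewrite Cmod_0. ring.
Qed.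

(* With [u] the coefficients of [g'], these are the coefficients of the
   right-hand side of the auxiliary equation divided by [g'^2], without its
   [a2 * gamma] term; [q] stands for [b h' + a2 p'' + a1 p' + a0 p]. *)
Definition forcing (a0 a1 gamma : C) (p q u : nat -> C) : nat -> C :=
  let G := pint u in
  padd
    (padd
       (pmul (padd (pdil (gamma ^ 2) G) (pscal (-1) (pcomp p (pdil gamma G))))
             (pscal gamma (pdil gamma u)))
       (pmul (pcomp q G) u))
    (padd (pscal (- a1 * gamma) (pdil gamma u))
          (pscal (- a0) (pmul (pdil gamma G) u))).

(** The integrated equation solved for its coefficient of degree [n]; at degree zero it reads
    [0 = 0], which leaves room for [eta]. *)
Definition coeff_step (a0 a1 a2 gamma eta : C) (p q u : nat -> C) (n : nat) : C :=
  match n with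
  | O => eta
  | S n => (pmul u (pavg (forcing a0 a1 gamma p q u)) n
            / (a2 * gamma * (gamma ^ S n - 1)))%C
  end.

Lemma agree_forcing a0 a1 gamma p q n u v :
  agree n u v ->
  agree n (forcing a0 a1 gamma p q u) (forcing a0 a1 gamma p q v).
Proof.
  intros H. unfold forcing. cbv zeta.
  repeat match goal with
    | |- agree _ (padd _ _) _ => apply agree_padd
    | |- agree _ (pmul _ _) _ => apply agree_pmul
    | |- agree _ (pscal _ _) _ => apply agree_pscal
    | |- agree _ (pdil _ _) _ => apply agree_pdil
    | |- agree _ (pcomp _ _) _ => apply agree_pcomp
    | |- agree _ (pint _) _ => apply agree_pint
    | _ => exact H
    end.
Qed.

Lemma agree_coeff_step a0 a1 a2 gamma eta p q n u v :
  agree n u v ->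
  agree (S n) (coeff_step a0 a1 a2 gamma eta p q u)
              (coeff_step a0 a1 a2 gamma eta p q v).
Proof.
  intros H [|k] Hk; [easy|]. unfold coeff_step. f_equal.
  apply (agree_pmul n); [easy| |lia]. now apply agree_pavg, agree_forcing.
Qed.

(** The primitive has norm at most [r * M], hence both compositions stay within radius [rho]. The
    resulting bound does not contain [r], which can therefore be chosen after it. *)
Lemma wnorm_forcing a0 a1 gamma p q u (W : nat -> R) (r rho M P : R) :
  weight W -> (forall n, W (S n) <= r * W n) -> Cmod gamma = 1 ->
  0 <= r <= 1 -> r * M <= rho ->
  (forall N, wnorm (fun n => rho ^ n) p N <= P) ->
  (forall N, wnorm (fun n => rho ^ n) q N <= P) ->
  (forall N, wnorm W u N <= M) ->
  forall N, wnorm W (forcing a0 a1 gamma p q u) N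
            <= (M + P) * M + P * M + Cmod a1 * M + Cmod a0 * (M * M).
Proof.
  intros HW HWS Hg Hr HrM Hp Hq Hu N.
  assert (H0 := fun a => wnorm_ge0 W HW a N).
  assert (HM : 0 <= M) by (apply Rle_trans with (2 := Hu N), H0).
  assert (HP : 0 <= P).
  { apply Rle_trans with (2 := Hp N). apply wnorm_ge0, weight_pow. nra. }
  assert (Hg2 : Cmod (gamma ^ 2)%C = 1) by (rewrite Cmod_pow, Hg; ring).
  assert (HG : wnorm W (pint u) N <= r * M).
  { apply Rle_trans with (1 := wnorm_pint W HW r u N (proj1 Hr) HWS).
    apply Rmult_le_compat_l; [easy|apply Hu]. }
  assert (HGM : wnorm W (pint u) N <= M) by nra.
  assert (Hpc : wnorm W (pcomp p (pdil gamma (pint u))) N <= P).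
  { apply Rle_trans with (2 := Hp N). apply wnorm_pcomp; [easy|].
    rewrite wnorm_pdil by easy. lra. }
  assert (Hqc : wnorm W (pcomp q (pint u)) N <= P).
  { apply Rle_trans with (2 := Hq N). apply wnorm_pcomp; [easy|]. lra. }
  assert (Hmul : forall a b A B, wnorm W a N <= A -> wnorm W b N <= B ->
            wnorm W (pmul a b) N <= A * B).
  { intros a b A B HA HB. apply Rle_trans with (1 := wnorm_pmul W HW a b N).
    apply Rmult_le_compat; easy. }
  unfold forcing. cbv zeta.
  apply Rle_trans with (1 := wnorm_padd W HW _ _ N).
  rewrite (Rplus_assoc (_ + _)).
  apply Rplus_le_compat; apply Rle_trans with (1 := wnorm_padd W HW _ _ N);
    apply Rplus_le_compat.
  - apply Hmul.
    + apply Rle_trans with (1 := wnorm_padd W HW _ _ N).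
      apply Rplus_le_compat; [now rewrite wnorm_pdil|].
      rewrite wnorm_pscal. replace (Cmod (-1)) with 1; [lra|].
      rewrite Cmod_R, Rabs_left; lra.
    + rewrite wnorm_pscal, wnorm_pdil, Hg by easy. specialize (Hu N). lra.
  - apply Hmul; [easy|apply Hu].
  - rewrite wnorm_pscal, wnorm_pdil, Cmod_mult, Cmod_opp, Hg by easy.
    rewrite Rmult_1_r. apply Rmult_le_compat_l; [apply Cmod_ge_0|apply Hu].
  - rewrite wnorm_pscal, Cmod_opp. apply Rmult_le_compat_l; [apply Cmod_ge_0|].
    apply Hmul; [now rewrite wnorm_pdil|apply Hu].
Qed.

(* The divisor [gamma^(n+1) - 1] is absorbed by the drop of the weight. *)
Lemma wnorm_coeff_step a0 a1 a2 gamma eta p q u (W : nat -> R) (r M F : R) :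
  weight W ->
  (forall n, W (S n) <= r * W n * Cmod (gamma ^ S n - 1)%C) ->
  (forall n, (gamma ^ S n)%C <> 1%C) ->
  Cmod gamma = 1 -> a2 <> RtoC 0 -> 0 <= r ->
  (forall N, wnorm W u N <= M) ->
  (forall N, wnorm W (forcing a0 a1 gamma p q u) N <= F) ->
  forall N, wnorm W (coeff_step a0 a1 a2 gamma eta p q u) N
            <= Cmod eta + r / Cmod a2 * (M * F).
Proof.
  intros HW HWS Hdiv Hg Ha2 Hr Hu HF N.
  assert (Ha2' := proj1 (Cmod_gt_0 a2) Ha2).
  set (f := pavg (forcing a0 a1 gamma p q u)).
  assert (Hf : forall N, wnorm W f N <= F).
  { intros n. apply Rle_trans with (2 := HF n). now apply wnorm_pavg. }
  assert (Hprod : forall N, wnorm W (pmul u f) N <= M * F).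
  { intros n. apply Rle_trans with (1 := wnorm_pmul W HW u f n).
    apply Rmult_le_compat; easy || now apply wnorm_ge0. }
  assert (Hr2 : 0 <= r / Cmod a2).
  { apply Rmult_le_pos; [easy|]. now apply Rlt_le, Rinv_0_lt_compat. }
  apply Rle_trans with (Cmod eta + r / Cmod a2 * wnorm W (pmul u f) N).
  2:{ apply Rplus_le_compat_l, Rmult_le_compat_l; [easy|apply Hprod]. }
  set (T := coeff_step a0 a1 a2 gamma eta p q u).
  assert (HT : forall k, Cmod (T (S k)) * W (S k)
                 <= r / Cmod a2 * (Cmod (pmul u f k) * W k)).
  { intros k. unfold T, coeff_step. fold f.
    assert (Hd : (gamma ^ S k - 1)%C <> RtoC 0).
    { intros E. apply (Hdiv k). now apply Ceq_minus. }
    assert (Hd' := proj1 (Cmod_gt_0 _) Hd).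
    assert (Hgam : gamma <> RtoC 0) by (intros E; rewrite E, Cmod_0 in Hg; lra).
    rewrite Cmod_div by (repeat apply Cmult_neq_0; easy).
    rewrite !Cmod_mult, Hg, Rmult_1_r.
    assert (Hm := Cmod_ge_0 (pmul u f k)). specialize (HWS k).
    set (d := Cmod (gamma ^ S k - 1)%C) in *.
    apply Rle_trans with (Cmod (pmul u f k) / (Cmod a2 * d) * (r * W k * d)).
    - apply Rmult_le_compat_l; [|easy].
      apply Rmult_le_pos; [easy|]. apply Rlt_le, Rinv_0_lt_compat. nra.
    - right. field. lra. }
  assert (H0 : Cmod (T O) * W O = Cmod eta).
  { rewrite (proj1 HW). simpl. ring. }
  cut (wnorm W T (S N) <= Cmod eta + r / Cmod a2 * wnorm W (pmul u f) N).
  { intros H. apply Rle_trans with (2 := H). apply sumR_mono; [|lia].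
    intros. now apply weighted_ge0. }
  unfold wnorm. induction N as [|N IH].
  - rewrite sumR_S, !sum_O, H0. specialize (HT O). lra.
  - rewrite (sumR_S _ (S N)), (sumR_S (fun n => Cmod (pmul u f n) * W n) N).
    specialize (HT (S N)). lra.
Qed.

Lemma formal_solution a0 a1 a2 gamma eta p q (K : nat -> R) (kappa rho : R) :
  a2 <> RtoC 0 -> eta <> RtoC 0 -> Cmod gamma = 1 ->
  0 < rho -> conv rho p -> conv rho q ->
  K 0%nat = 0 -> (forall i j, K i + K j <= K (i + j)%nat) ->
  (forall n, 0 <= K n <= kappa * INR n) ->
  (forall n, exp (K n - K (S n)) <= Cmod (gamma ^ S n - 1)%C) ->
  exists (u : nat -> C) (r : R), 0 < r /\ u O = eta /\ conv r u /\
    (forall N, wnorm (fun n => r ^ n) (pint u) N <= rho) /\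
    (forall n, (a2 * gamma * (gamma ^ n - 1) * u n)%C
               = pmul u (pint (forcing a0 a1 gamma p q u)) n).
Proof.
  intros Ha2 Heta Hg Hrho [P1 HP1] [P2 HP2] HK0 HKs HKb HKd.
  assert (Ha2' := proj1 (Cmod_gt_0 a2) Ha2).
  assert (Heta' := proj1 (Cmod_gt_0 eta) Heta).
  assert (Hgam : gamma <> RtoC 0) by (intros E; rewrite E, Cmod_0 in Hg; lra).
  assert (Hdiv : forall n, (gamma ^ S n)%C <> 1%C).
  { intros n E. specialize (HKd n). rewrite E in HKd.
    replace (1 - 1)%C with (RtoC 0) in HKd by ring. rewrite Cmod_0 in HKd.
    assert (H := exp_pos (K n - K (S n))). lra. }
  set (P := Rmax P1 P2).
  set (M := 2 * Cmod eta).
  set (F := (M + P) * M + P * M + Cmod a1 * M + Cmod a0 * (M * M)).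
  assert (HM : 0 < M) by (unfold M; lra).
  assert (HP : 0 <= P).
  { apply Rle_trans with P1; [|apply Rmax_l].
    apply Rle_trans with (2 := HP1 O). apply wnorm_ge0, weight_pow. lra. }
  assert (HF : 0 < F).
  { unfold F. assert (H0 := Cmod_ge_0 a0). assert (H1 := Cmod_ge_0 a1).
    assert (0 < M * M) by nra. assert (0 <= P * M) by nra.
    assert (0 <= Cmod a1 * M) by nra. assert (0 <= Cmod a0 * (M * M)) by nra. nra. }
  (* The entries ensure in turn [r <= 1], compositions within radius [rho], and a recursive part of
     norm at most [|eta|]. *)
  set (r := Rmin 1 (Rmin (rho / M) (Cmod a2 * Cmod eta / (M * F)))).
  assert (HMF : 0 < M * F) by nra.
  assert (Hr0 : 0 < r).
  { repeat apply Rmin_pos; [lra|now apply Rdiv_lt_0_compat|].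
    apply Rdiv_lt_0_compat; [nra|easy]. }
  assert (Hr1 : r <= 1) by apply Rmin_l.
  assert (HrM : r * M <= rho).
  { apply Rle_trans with (rho / M * M); [|right; field; lra].
    apply Rmult_le_compat_r; [lra|].
    apply Rle_trans with (1 := Rmin_r _ _), Rmin_l. }
  assert (HrF : r / Cmod a2 * (M * F) <= Cmod eta).
  { apply Rle_trans with (Cmod a2 * Cmod eta / (M * F) / Cmod a2 * (M * F));
      [|right; field; lra].
    apply Rmult_le_compat_r; [lra|]. apply Rmult_le_compat_r.
    - now apply Rlt_le, Rinv_0_lt_compat.
    - apply Rle_trans with (1 := Rmin_r _ _), Rmin_r. }
  set (W := fun n => r ^ n * exp (- K n)).
  assert (HW : weight W).
  { unfold W. repeat split.
    - rewrite HK0, Ropp_0, exp_0. simpl. ring.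
    - intros n. apply Rmult_le_pos; [apply pow_le; lra|apply Rlt_le, exp_pos].
    - intros i j. rewrite pow_add.
      replace (r ^ i * exp (- K i) * (r ^ j * exp (- K j)))
        with (r ^ i * r ^ j * exp (- K i + - K j)) by (rewrite exp_plus; ring).
      apply Rmult_le_compat_l; [apply Rmult_le_pos; apply pow_le; lra|].
      apply exp_le_exp. specialize (HKs i j). lra. }
  assert (HWeq : forall n, W (S n) = r * W n * exp (K n - K (S n))).
  { intros n. unfold W. simpl.
    replace (- K (S n)) with (- K n + (K n - K (S n))) by ring.
    rewrite exp_plus. ring. }
  assert (HrW : forall n, 0 <= r * W n).
  { intros n. apply Rmult_le_pos; [lra|apply HW]. }
  assert (HWd : forall n, W (S n) <= r * W n * Cmod (gamma ^ S n - 1)%C).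
  { intros n. rewrite HWeq. now apply Rmult_le_compat_l. }
  (* [K] is monotone, by superadditivity and [0 <= K 1]. *)
  assert (HWr : forall n, W (S n) <= r * W n).
  { intros n. rewrite HWeq. rewrite <- (Rmult_1_r (r * W n)) at 2.
    apply Rmult_le_compat_l; [easy|].
    rewrite <- exp_0. apply exp_le_exp.
    specialize (HKs n 1%nat). rewrite Nat.add_1_r in HKs.
    specialize (HKb 1%nat). lra. }
  destruct (causal_fixpoint (coeff_step a0 a1 a2 gamma eta p q) W M)
    as [u [Hfix Hu]].
  - intros n u v. apply agree_coeff_step.
  - easy.
  - lra.
  - intros u Hu N.
    apply Rle_trans with (Cmod eta + r / Cmod a2 * (M * F)); [|unfold M in *; lra].
    apply wnorm_coeff_step; try easy; [lra|].
    apply (wnorm_forcing a0 a1 gamma p q u W r rho M P); try easy; [lra| |].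
    + intros n. apply Rle_trans with (1 := HP1 n), Rmax_l.
    + intros n. apply Rle_trans with (1 := HP2 n), Rmax_r.
  (* From [K n <= kappa n], the geometric weight [r' ^ n] lies below [W n]. *)
  - set (r' := r * exp (- kappa)).
    assert (Hk : 0 <= kappa) by (specialize (HKb 1%nat); simpl in HKb; lra).
    assert (Hr' : 0 < r') by (apply Rmult_lt_0_compat; [easy|apply exp_pos]).
    assert (Hrr : r' <= r).
    { unfold r'. rewrite <- (Rmult_1_r r) at 2. apply Rmult_le_compat_l; [lra|].
      rewrite <- exp_0. apply exp_le_exp. lra. }
    assert (HW' : forall n, r' ^ n <= W n).
    { intros n. unfold r', W. rewrite Rpow_mult_distr.
      apply Rmult_le_compat_l; [apply pow_le; lra|].
      replace (exp (- kappa) ^ n) with (exp (- (kappa * INR n))).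
      - apply exp_le_exp. specialize (HKb n). lra.
      - clear. induction n as [|n IH].
        + simpl. rewrite Rmult_0_r, Ropp_0. apply exp_0.
        + rewrite S_INR. simpl. rewrite <- IH, <- exp_plus. f_equal. ring. }
    assert (Hu' : forall N, wnorm (fun n => r' ^ n) u N <= M).
    { intros N. apply Rle_trans with (2 := Hu N). apply sumR_le. intros k _.
      apply Rmult_le_compat_l; [apply Cmod_ge_0|apply HW']. }
    exists u, r'. split; [easy|]. split; [now rewrite <- (Hfix O)|].
    split; [now exists M|]. split.
    + intros N. apply Rle_trans with (r' * wnorm (fun n => r' ^ n) u N).
      * apply wnorm_pint; [apply weight_pow; lra|lra|]. intros n. simpl. lra.
      * specialize (Hu' N). assert (H := wnorm_ge0 _ (weight_pow r' ltac:(lra)) u N). nra.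
    + intros [|n].
      * unfold pmul. rewrite sum_O. simpl. ring.
      * rewrite pmul_pint_S, <- (Hfix (S n)). unfold coeff_step at 1.
        field. repeat split; try easy. intros E. apply (Hdiv n), Ceq_minus, E.
Qed.

(** * The analytic solution *)

Lemma is_derive_dilated (r : R) (u : nat -> C) (c z : C) :
  conv r u -> Cmod c = 1 -> Cmod z < r ->
  @is_derive C_AbsRing (AbsRing_NormedModule C_AbsRing)
    (fun w => ev u (c * w)%C) z (c * ev (pder u) (c * z))%C.
Proof.
  intros Hu Hc Hz.
  apply (is_derive_comp (V := AbsRing_NormedModule C_AbsRing) (ev u)
           (fun w : C_AbsRing => (c * w)%C)).
  - apply (is_derive_ev r); [easy|]. now rewrite Cmod_mult, Hc, Rmult_1_l.
  - assert (H := is_derive_mult (K := C_AbsRing) (fun _ => c) (fun w => w) z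
              (RtoC 0) (RtoC 1) (is_derive_const _ _) (is_derive_id _) Cmult_comm).
    evar_last; [exact H|]. change (0 * z + c * 1 = c)%C. ring.
Qed.

(** Differentiation undoes [pint]. The relation holds on a whole disc, hence near [z], so both sides
    have the same derivative there. *)
Lemma C_derive_linear_relation (r : R) (u psi : nat -> C) (A c z : C) :
  conv r u -> conv r psi -> Cmod c = 1 ->
  (forall w, Cmod w < r ->
     (A * (ev u (c * w) - ev u w) = ev u w * ev (pint psi) w)%C) ->
  Cmod z < r ->
  (A * (c * ev (pder u) (c * z) - ev (pder u) z)
   = ev (pder u) z * ev (pint psi) z + ev u z * ev psi z)%C.
Proof.
  intros Hu Hpsi Hc Heq Hz.
  assert (Hr : 0 <= r) by (assert (H := Cmod_ge_0 z); lra).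
  assert (H1 : @is_derive C_AbsRing (AbsRing_NormedModule C_AbsRing)
     (fun w => A * (ev u (c * w) - ev u w))%C z
     (A * (c * ev (pder u) (c * z) - ev (pder u) z))%C).
  { assert (H := is_derive_mult (K := C_AbsRing) (fun _ => A)
      (fun w => minus (ev u (c * w)%C) (ev u w)) z (RtoC 0) _ (is_derive_const _ _)
      (is_derive_minus (V := AbsRing_NormedModule C_AbsRing) _ _ _ _ _
        (is_derive_dilated r u c z Hu Hc Hz) (is_derive_ev r u z Hu Hz)) Cmult_comm).
    evar_last; [exact H|].
    change (0 * (ev u (c * z) - ev u z) + A * (c * ev (pder u) (c * z) - ev (pder u) z)
            = A * (c * ev (pder u) (c * z) - ev (pder u) z))%C. ring. }
  assert (Hpint : ev (pder (pint psi)) z = ev psi z).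
  { apply ev_ext; [apply pder_pint|]. apply (conv_pder r).
    - split; [apply Cmod_ge_0|easy].
    - now apply conv_pint. }
  assert (H2 : @is_derive C_AbsRing (AbsRing_NormedModule C_AbsRing)
     (fun w => ev u w * ev (pint psi) w)%C z
     (ev (pder u) z * ev (pint psi) z + ev u z * ev psi z)%C).
  { rewrite <- Hpint.
    apply (is_derive_mult (K := C_AbsRing) (ev u) (ev (pint psi)));
      [now apply (is_derive_ev r)|apply (is_derive_ev r); [now apply conv_pint|easy]
      |apply Cmult_comm]. }
  rewrite <- (is_derive_AbsRing_C_derive _ _ _ H2). symmetry.
  apply is_derive_AbsRing_C_derive.
  apply (is_derive_ext_loc (V := AbsRing_NormedModule C_AbsRing))
    with (2 := H1).
  apply filter_imp with (2 := locally_Cmod_lt z r Hz). exact Heq.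
Qed.

Ltac conv_tac :=
  repeat match goal with
    | H : conv ?r ?a |- conv ?r ?a => exact H
    | |- conv _ (padd _ _) => apply conv_padd
    | |- conv _ (pscal _ _) => apply conv_pscal
    | |- conv _ (pdil _ _) => apply conv_pdil
    | |- conv _ (pmul _ _) => apply conv_pmul
    | |- conv _ (pint _) => apply conv_pint
    | |- 0 <= _ => first [assumption | apply Cmod_ge_0 | lra]
    end.

Ltac ev_push :=
  repeat match goal with
    | |- context [ev (padd ?a ?b) ?z] => rewrite (ev_padd a b z)
    | |- context [ev (pscal ?c ?a) ?z] => rewrite (ev_pscal c a z)
    | |- context [ev (pdil ?c ?a) ?z] => rewrite (ev_pdil c a z)
    | |- context [ev (pmul ?a ?b) ?z] => rewrite (ev_pmul a b z)
    end.

Theorem theorem2p2 (a0 a1 a2 b : C) (ha2 : a2 <> RtoC 0)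
  (p h : C -> C) (hp : analytic_near0 p) (hh : analytic_near0 h)
  (gamma : C) (hgamma : ~ root_of_unity gamma)
  (theta : R) (htheta : brjuno theta)
  (hexp : gamma = Cexp (2 * PI * Ci * theta)%C)
  (eta : C) (heta : eta <> RtoC 0) :
  exists (g : C -> C) (c : nat -> C),
    c O = RtoC 0 /\
    expands_near0 g c /\
    locally (RtoC 0) (auxiliary_equation a0 a1 a2 b p h gamma g) /\
    g (RtoC 0) = RtoC 0 /\
    C_derive g (RtoC 0) = eta.
Proof.
  destruct hp as [pc Hpc], hh as [hc Hhc].
  destruct (expands_near0_conv p pc Hpc) as [rp [Hrp [Hpconv Hpev]]].
  destruct (expands_near0_conv h hc Hhc) as [rh [Hrh [Hhconv Hhev]]].
  set (R0 := Rmin rp rh).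
  assert (HR0 : 0 < R0) by now apply Rmin_pos.
  assert (HRp : R0 <= rp) by apply Rmin_l.
  assert (HRh : R0 <= rh) by apply Rmin_r.
  (* Each derivative of [p] costs radius: the first converges below [R0], the second is controlled
     below [R0 / 2], and [R0 / 4] is strictly inside. *)
  set (rho := R0 / 4).
  (* The terms evaluated at [g z] all carry [g' z ^ 3], so a single outer series, hence a single
     composition, covers them. *)
  set (q := padd (pscal b (pder hc)) (padd (pscal a2 (pder (pder pc)))
              (padd (pscal a1 (pder pc)) (pscal a0 pc)))).
  assert (Hp0 : forall s, 0 <= s < R0 -> conv s pc)
    by (intros s Hs; apply (conv_le rp); [lra|easy]).
  assert (Hp1 : forall s, 0 <= s < R0 -> conv s (pder pc))
    by (intros s Hs; apply (conv_pder rp); [lra|easy]).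
  assert (Hp2 : forall s, 0 <= s < R0 / 2 -> conv s (pder (pder pc)))
    by (intros s Hs; apply (conv_pder (R0 / 2)); [lra|apply Hp1; lra]).
  assert (Hh1 : forall s, 0 <= s < R0 -> conv s (pder hc))
    by (intros s Hs; apply (conv_pder rh); [lra|easy]).
  assert (Hq : forall s, 0 <= s < R0 / 2 -> conv s q).
  { intros s Hs. unfold q.
    specialize (Hp0 s ltac:(lra)). specialize (Hp1 s ltac:(lra)).
    specialize (Hp2 s Hs). specialize (Hh1 s ltac:(lra)). conv_tac. }
  assert (Hqev : forall w, Cmod w <= rho ->
    ev q w = (b * C_derive h w + (a2 * C_derive (C_derive p) w
              + (a1 * C_derive p w + a0 * p w)))%C).
  { intros w Hw. assert (Hw0 := Cmod_ge_0 w). unfold rho in Hw.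
    assert (Hs : 0 <= Cmod w < R0 / 2) by lra.
    assert (Hs' : 0 <= Cmod w < R0) by lra.
    specialize (Hp0 _ Hs'). specialize (Hp1 _ Hs'). specialize (Hp2 _ Hs).
    specialize (Hh1 _ Hs'). unfold q.
    ev_push; conv_tac.
    rewrite (C_derive_near_ev rh h hc w), (C_derive_near_ev rp p pc w),
      (C_derive2_near_ev rp (R0 / 2) p pc w), (Hpev w); easy || lra. }
  destruct (superadditive_majorant theta htheta) as [K [kappa [HK0 [HKs [HKb HKd]]]]].
  assert (Hgam1 : Cmod gamma = 1) by (rewrite hexp; apply Cmod_Cexp_angle).
  destruct (formal_solution a0 a1 a2 gamma eta pc q K kappa rho)
    as [u [r [Hr [Hu0 [Hu [HG Hrel]]]]]]; try easy.
  { unfold rho. lra. }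
  { apply Hp0. unfold rho. lra. }
  { apply Hq. unfold rho. lra. }
  { intros n. destruct (small_divisor_lower theta (S n)) as [k Hk].
    rewrite hexp. apply Rle_trans with (2 := Hk). apply HKd. }
  set (psi := forcing a0 a1 gamma pc q u) in *.
  set (G := pint u) in *.
  assert (HGc : conv r G) by (now apply conv_pint; [lra|]).
  assert (HGd : conv r (pdil gamma G)) by now apply conv_pdil.
  assert (Hgam2 : Cmod (gamma ^ 2)%C = 1) by (rewrite Cmod_pow, Hgam1; ring).
  assert (HGdN : forall N, wnorm (fun n => r ^ n) (pdil gamma G) N <= rho)
    by (intros N; now rewrite wnorm_pdil).
  assert (Hpcr : conv rho pc) by (apply Hp0; unfold rho; lra).
  assert (Hqr : conv rho q) by (apply Hq; unfold rho; lra).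
  assert (Hpcomp : conv r (pcomp pc (pdil gamma G)))
    by (apply (conv_pcomp r rho); easy || lra).
  assert (Hqcomp : conv r (pcomp q G)) by (apply (conv_pcomp r rho); easy || lra).
  assert (Hpsi : conv r psi).
  { unfold psi, forcing. cbv zeta. fold G.
    assert (0 <= r) by lra. conv_tac; easy. }
  assert (Hsmall : forall z, Cmod z < r ->
            forall N, wnorm (fun n => Cmod z ^ n) G N <= rho).
  { intros z Hz N. apply Rle_trans with (2 := HG N). apply sumR_le. intros k _.
    apply Rmult_le_compat_l; [apply Cmod_ge_0|].
    apply pow_incr. split; [apply Cmod_ge_0|lra]. }
  assert (Hscale : forall c z, Cmod c = 1 -> Cmod (c * z)%C = Cmod z)
    by (intros c z Hc; rewrite Cmod_mult, Hc; ring).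
  assert (Hg1 : forall z, Cmod z < r -> C_derive (ev G) z = ev u z).
  { intros z Hz. rewrite (C_derive_near_ev r (ev G) G z) by easy.
    apply ev_ext; [apply pder_pint|].
    apply (conv_pder r); [split; [apply Cmod_ge_0|easy]|easy]. }
  assert (Hg2 : forall z, Cmod z < r -> C_derive (C_derive (ev G)) z = ev (pder u) z).
  { intros z Hz. now apply (C_derive_near_ev r (C_derive (ev G)) u z). }
  assert (Hpsiev : forall z, Cmod z < r ->
    ev psi z = ((ev G (gamma ^ 2 * z) - p (ev G (gamma * z)))
                  * (gamma * ev u (gamma * z))
                + ev q (ev G z) * ev u z
                + (- a1 * gamma * ev u (gamma * z)
                   + - a0 * (ev G (gamma * z) * ev u z)))%C).
  { intros z Hz. assert (Hz0 := Cmod_ge_0 z).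
    assert (Hle : forall a, conv r a -> conv (Cmod z) a)
      by (intros a; apply conv_le; lra).
    (* [p] equals its series only near the origin; the norm bound on [G] keeps the argument
       there. *)
    assert (HGz : Cmod (ev G (gamma * z)) <= rho)
      by (apply Cmod_ev_le, Hsmall; now rewrite Hscale).
    unfold psi, forcing. cbv zeta. fold G.
    assert (Hpp : p (ev G (gamma * z)) = ev pc (ev G (gamma * z)))
      by (apply Hpev; unfold rho in *; lra).
    rewrite Hpp.
    assert (Huz := Hle u Hu). assert (HGz' := Hle G HGc).
    assert (Hpz := Hle _ Hpcomp). assert (Hqz := Hle _ Hqcomp).
    ev_push; rewrite ?Hscale by easy; conv_tac; try easy.
    rewrite (ev_pcomp rho pc), (ev_pcomp rho q), ev_pdil;
      rewrite ?Hscale by easy; try easy.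
    + ring.
    + now apply Hsmall.
    + apply Cmult_0_r.
    + intros N. rewrite wnorm_pdil by easy. now apply Hsmall. }
  (* The coefficient relation [Hrel] read as an identity of functions, ready to be
     differentiated. *)
  assert (Hfun : forall w, Cmod w < r ->
    (a2 * gamma * (ev u (gamma * w) - ev u w) = ev u w * ev (pint psi) w)%C).
  { intros w Hw. assert (Hw0 := Cmod_ge_0 w).
    assert (Huw : conv (Cmod w) u) by (apply (conv_le r); [lra|easy]).
    assert (Hpw : conv (Cmod w) (pint psi)).
    { apply (conv_le r); [lra|]. apply conv_pint; [lra|easy]. }
    rewrite <- ev_pmul by easy.
    rewrite <- (ev_ext (pscal (a2 * gamma) (padd (pdil gamma u) (pscal (-1) u)))
                      (pmul u (pint psi))).
    - ev_push; rewrite ?Hscale by easy; conv_tac; try easy. ring.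
    - intros n. rewrite <- Hrel. unfold pscal, padd, pdil. ring.
    - conv_tac. easy. }
  exists (ev G), G. repeat split.
  - now apply (expands_near0_ev r).
  - apply locally_0_Cmod. exists r. split; [easy|]. intros z Hz.
    unfold auxiliary_equation. cbv zeta.
    assert (Hgz : Cmod (gamma * z)%C < r) by now rewrite Hscale.
    rewrite (Hg1 z Hz), (Hg1 _ Hgz), (Hg2 z Hz), (Hg2 _ Hgz).
    assert (E1 := Hfun z Hz).
    assert (E2 := C_derive_linear_relation r u psi (a2 * gamma)%C gamma z
                    Hu Hpsi Hgam1 Hfun Hz).
    rewrite (Hpsiev z Hz), (Hqev (ev G z)) in E2
      by (apply Cmod_ev_le, Hsmall, Hz).
    set (A := ev u (gamma * z)%C) in *. set (B := ev u z) in *.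
    set (A' := ev (pder u) (gamma * z)%C) in *. set (B' := ev (pder u) z) in *.
    set (F := ev (pint psi) z) in *.
    match type of E2 with (_ = _ + _ * ?X)%C => set (Psi := X) in * end.
    (* The combination [B * E2 - B' * E1] eliminates the primitive [F]. It recovers the equation
       without dividing by [g'], which may vanish away from the origin. *)
    transitivity (B * (a2 * gamma * (gamma * A' - B')) - B' * (a2 * gamma * (A - B))
                  + a2 * gamma * A * B')%C; [ring|].
    rewrite E1, E2. unfold Psi. ring.
  - rewrite ev_0. easy.
  - rewrite Hg1, ev_0; [easy|]. now rewrite Cmod_0.
Qed.
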